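(* Let $\varepsilon>0$ and let $(u_\varepsilon,v_\varepsilon)\in H^1(0,L)\times H^1(0,L)$ be a critical point of the obstacle functional $\overline{AT}_\varepsilon$ (with obstacle $v_{0,\varepsilon}$). Then $v_\varepsilon\in C^{1,1}([0,L])$.
   Context: Fix $L>0$, $a_0,a_1\in\mathbb{R}$, $\varepsilon>0$, $\eta_\varepsilon>0$. For $(u,v)\in H^1(0,L)^2$ let $AT_\varepsilon(u,v)=\int_0^L\big((\eta_\varepsilon+v^2)|u'|^2+\frac{(1-v)^2}{\varepsilon}+\varepsilon|v'|^2\big)dx$. Obstacle: $(u_{0,\varepsilon},v_{0,\varepsilon})\in H^1(0,L)^2$ is a fixed critical point of $AT_\varepsilon$, i.e. $u_{0,\varepsilon}(0)=0$, $u_{0,\varepsilon}(L)=a_0$, $v_{0,\varepsilon}(0)=v_{0,\varepsilon}(L)=1$, and the directional derivative of $AT_\varepsilon$ at $(u_{0,\varepsilon},v_{0,\varepsilon})$ vanishes in every direction $(\psi,\varphi)\in C_c^\infty(0,L)^2$; equivalently $[u_{0,\varepsilon}'(\eta_\varepsilon+v_{0,\varepsilon}^2)]'=0$ and $-\varepsilon v_{0,\varepsilon}''+\frac{v_{0,\varepsilon}-1}{\varepsilon}+v_{0,\varepsilon}|u_{0,\varepsilon}'|^2=0$ in $(0,L)$. Obstacle functional: $\overline{AT}_\varepsilon(u,v)=AT_\varepsilon(u,v)$ if $v\le v_{0,\varepsilon}$ and $+\infty$ otherwise. A critical point of $\overline{AT}_\varepsilon$ is a pair $(u_\varepsilon,v_\varepsilon)\in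 H^1(0,L)^2$ with $v_\varepsilon\le v_{0,\varepsilon}$, $u_\varepsilon(0)=0$, $u_\varepsilon(L)=a_1$, $v_\varepsilon(0)=v_\varepsilon(L)=1$, such that for all $\psi,\varphi\in C_c^\infty(0,L)$ the limit $D(\psi,\varphi)=\lim_{t\to0^+}\frac{AT_\varepsilon(u_\varepsilon,v_\varepsilon)-AT_\varepsilon(u_\varepsilon-t\psi,v_\varepsilon-t\varphi)}{t}$ satisfies $D(\psi,\varphi)\le0$ whenever $\varphi\ge0$, and $D(\psi,\varphi)=0$ whenever $\varphi$ is supported in $O_\varepsilon=\{v_\varepsilon<v_{0,\varepsilon}\}$. Equivalently, $[u_\varepsilon'(\eta_\varepsilon+v_\varepsilon^2)]'=0$ and $-\varepsilon v_\varepsilon''+\frac{v_\varepsilon-1}{\varepsilon}+v_\varepsilon|u_\varepsilon'|^2=\mu_\varepsilon$ in the sense of distributions on $(0,L)$, where $\mu_\varepsilon$ is a nonpositive Radon measure supported on $F_\varepsilon=\{v_\varepsilon=v_{0,\varepsilon}\}$. *)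

(* Defs.v *)
From HB Require Import structures.
From mathcomp Require Import all_boot all_order all_algebra.
From mathcomp Require Import all_classical all_reals all_analysis.
Set Implicit Arguments.
Unset Strict Implicit.
Unset Printing Implicit Defensive.
Import Order.TTheory GRing.Theory Num.Theory numFieldNormedType.Exports.
Local Open Scope classical_set_scope.
Local Open Scope ring_scope.

Definition supp {R : realType} (f : R -> R) : set R :=
  closure [set x | f x != 0].

(* C_c^oo(0, L), each test function being extended by 0 to the real line.
   Compactness of the support is automatic: it is closed and bounded. *)
Definition test_fun {R : realType} (L : R) (f : R -> R) : Prop :=
  (forall (n : nat) (x : R), derivable (derive1n n f) x 1) /\ supp f `<=` `]0, L[.

Definition L2 {R : realType} (L : R) (f : R -> R) : Prop :=
  measurable_fun `]0, L[ f /\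
  (@lebesgue_measure R).-integrable `]0, L[ (fun x => (f x ^+ 2)%:E).

Definition weak_derivative {R : realType} (L : R) (u g : R -> R) : Prop :=
  forall f : R -> R, test_fun L f ->
    \int[lebesgue_measure]_(x in `]0, L[) (u x * derive1 f x) =
    - \int[lebesgue_measure]_(x in `]0, L[) (g x * f x).

(* An element of H^1(0, L) is given by its continuous representative on
   [0, L]; values outside [0, L] are irrelevant. *)
Definition H1 {R : realType} (L : R) (u : R -> R) : Prop :=
  [/\ {within `[0, L], continuous u},
      L2 L u &
      exists g : R -> R, L2 L g /\ weak_derivative L u g].

(* A representative of the weak derivative, which is unique almost everywhere
   on (0, L). *)
Definition weakD {R : realType} (L : R) (u : R -> R) : R -> R :=
  xget (cst 0) [set g | L2 L g /\ weak_derivative L u g].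

(* On H^1 x H^1 the integrand is integrable, since v is bounded on [0, L], so
   the real-valued integral is the genuine one there. *)
Definition AT {R : realType} (L eps eta : R) (u v : R -> R) : R :=
  \int[lebesgue_measure]_(x in `]0, L[)
    ((eta + v x ^+ 2) * `|weakD L u x| ^+ 2
     + (1 - v x) ^+ 2 / eps + eps * `|weakD L v x| ^+ 2).

Definition AT_critical {R : realType} (L a0 eps eta : R) (u0 v0 : R -> R)
    : Prop :=
  [/\ H1 L u0 /\ H1 L v0,
      u0 0 = 0 /\ u0 L = a0,
      v0 0 = 1 /\ v0 L = 1 &
      forall psi phi : R -> R, test_fun L psi -> test_fun L phi ->
        (AT L eps eta (fun x => u0 x + t * psi x) (fun x => v0 x + t * phi x)
           - AT L eps eta u0 v0) / t @[t --> 0^'] --> 0].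

(* Critical points of the functional equal to AT where v <= v0 and to +oo
   elsewhere; D is a one-sided derivative of the finite functional AT. *)
Definition obstacle_AT_critical {R : realType} (L a1 eps eta : R)
    (v0 u v : R -> R) : Prop :=
  [/\ H1 L u /\ H1 L v,
      forall x : R, x \in `[0, L] -> v x <= v0 x,
      u 0 = 0 /\ u L = a1,
      v 0 = 1 /\ v L = 1 &
      forall psi phi : R -> R, test_fun L psi -> test_fun L phi ->
        exists D : R,
          [/\ (AT L eps eta u v
                 - AT L eps eta (fun x => u x - t * psi x)
                                (fun x => v x - t * phi x)) / t
                @[t --> 0^'+] --> D,
              (forall x, 0 <= phi x) -> D <= 0 &
              supp phi `<=` [set x | (x \in `]0, L[) /\ v x < v0 x] -> D = 0]].

(* g is the derivative of f relative to [a, b], one-sided at the endpoints;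
   f is then C^1 up to the boundary. *)
Definition C11 {R : realType} (a b : R) (f : R -> R) : Prop :=
  exists g : R -> R,
    (forall x : R, x \in `[a, b] ->
       (f y - f x) / (y - x) @[y --> within `[a, b] x^'] --> g x) /\
    [lipschitz g x | x in `[a, b]].

(* Main.v *)
(** Both equations are used in weak form only. The first one says that
    [u' (eta + v^2)] is constant, so [u'] is bounded; hence, tested against
    [phi >= 0], the second one gives [eps v'' >= - M] on the whole interval,
    [eps v'' <= M] on the open set [v < v0], and [eps v0'' <= M0] for the
    obstacle. Smoothed tent functions turn these into bounds on the second
    differences [v (c + d) + v (c - d) - 2 v c]. At a contact point [v] touches
    [v0] from below, so its second difference is at most that of [v0]. Thus the
    second differences of [v] are locally of order [d^2] on both sides, which by
    a minimum argument makes [v - C x^2 / 2] concave and [v + C x^2 / 2] convex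
    on the closed interval, and such a [v] is C^{1,1}. *)
Require Import Defs.
From HB Require Import structures.
From mathcomp Require Import all_boot all_order all_algebra.
From mathcomp Require Import all_classical all_reals all_analysis.
From mathcomp Require Import measurable_realfun ring lra.
Import Order.TTheory GRing.Theory Num.Theory numFieldNormedType.Exports.
Local Open Scope classical_set_scope.
Local Open Scope ring_scope.
Set Implicit Arguments.
Unset Strict Implicit.
Unset Printing Implicit Defensive.

(** * Semiconcave functions *)

(** The difficulty is that nothing is known about the contact set: no equation for [v] holds on it,
    and the radius on which a local upper estimate holds degenerates as a point approaches it or the
    ends of the interval. The measure is therefore never constructed. Second differences use only
    the continuous representatives, and comparing three values is enough to carry an estimate from
    the obstacle to [v] at a contact point.

    The local estimates share a constant but no radius. The minimum argument accepts this at the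
    price of a strictly larger constant, whence [C = K + K0 + 1] with [K = M / eps] and
    [K0 = M0 / eps]. Here [M] bounds [(v - 1) / eps + v (c / (eta + v^2))^2], where [c] is the
    constant value of [u' (eta + v^2)], and [M0] does the same for the obstacle pair. Concavity and
    convexity are then stated on triples of the closed interval, so that regularity up to the
    boundary needs no separate argument. *)

(** Concavity of [w - C x^2 / 2], cleared of denominators: the product on the right is the value of
    the left-hand side at [w = x^2]. *)
Definition semiconcave {R : realType} (L C : R) (w : R -> R) : Prop :=
  forall x y z, 0 <= x -> x < y -> y < z -> z <= L ->
    (z - y) * w x + (y - x) * w z - (z - x) * w y
      <= C / 2 * ((z - x) * (z - y) * (y - x)).

Definition second_diff {R : realType} (w : R -> R) (c d : R) : R :=
  w (c + d) + w (c - d) - 2 * w c.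

Section semiconcave.
Context {R : realType}.
Implicit Types (L K C : R) (w g : R -> R).

(** If the inequality fails on [x < y < z], the function [f], which is [z - x] times the gap between
    [w - C t^2 / 2] and its chord, vanishes at [x] and [z] and is negative at [y]. At an interior
    minimum its second differences are nonnegative, whereas they equal
    [(z - x) (second_diff w c d - C d^2)], negative for small [d] because [K < C]. Only the radius
    at that one minimum matters. *)
Lemma semiconcave_local L K C w : K < C ->
  {within `[0, L], continuous w} ->
  (forall c, 0 < c -> c < L -> exists2 e, 0 < e &
     forall d, 0 < d -> d < e -> second_diff w c d <= K * d ^+ 2) ->
  semiconcave L C w.
Proof.
move=> KC wc loc x y z x0 xy yz zL.
rewrite leNgt; apply/negP => bad.
pose f t := (z - x) * w t - (z - t) * w x - (t - x) * w z
            + C / 2 * ((z - x) * (z - t) * (t - x)).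
have xz : x < z by lra.
have fc : {within `[x, z], continuous f}.
  have wc' : {within `[x, z], continuous w}.
    apply: continuous_subspaceW wc => t /=; rewrite !in_itv/= => /andP[? ?].
    by apply/andP; split; lra.
  apply/subspace_continuousP => t txz.
  have wt : w s @[s --> within `[x, z] (nbhs t)] --> w t.
    by move: t txz; apply/subspace_continuousP.
  have it : s @[s --> within `[x, z] (nbhs t)] --> t.
    exact: cvg_within_filter cvg_id.
  apply: cvgD; first apply: cvgB; first apply: cvgB.
  - by apply: cvgM wt; exact: cvg_cst.
  - by apply: cvgM; [apply: cvgB => //; exact: cvg_cst|exact: cvg_cst].
  - by apply: cvgM; [apply: cvgB => //; exact: cvg_cst|exact: cvg_cst].
  apply: cvgM; first exact: cvg_cst.
  apply: cvgM; last by apply: cvgB => //; exact: cvg_cst.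
  by apply: cvgM; [exact: cvg_cst|apply: cvgB => //; exact: cvg_cst].
have [c cxz fmin] := EVT_min (ltW xz) fc.
have fx : f x = 0 by rewrite /f; ring.
have fz : f z = 0 by rewrite /f; ring.
have fy : f y < 0 by rewrite /f; lra.
have fcy : f c <= f y by apply: fmin; rewrite in_itv/=; apply/andP; split; lra.
have xc : x < c.
  rewrite lt_neqAle; apply/andP; split; last by move: cxz; rewrite in_itv => /andP[].
  by apply/eqP => xE; move: fcy; rewrite -xE fx; lra.
have cz : c < z.
  rewrite lt_neqAle; apply/andP; split; last by move: cxz; rewrite in_itv => /andP[].
  by apply/eqP => xE; move: fcy; rewrite xE fz; lra.
have [||e e0 he] := loc c; [lra|lra|].
pose d := Num.min (e / 2) (Num.min (c - x) (z - c)).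
have d0 : 0 < d by rewrite !lt_min; apply/and3P; split; lra.
have de : d < e by rewrite gt_min; apply/orP; left; lra.
have dx : d <= c - x by rewrite !ge_min lexx /= orbT.
have dz : d <= z - c by rewrite !ge_min lexx /= !orbT.
have h1 : f c <= f (c + d) by apply: fmin; rewrite in_itv/=; apply/andP; split; lra.
have h2 : f c <= f (c - d) by apply: fmin; rewrite in_itv/=; apply/andP; split; lra.
have h3 := he d d0 de.
have h4 : f (c + d) + f (c - d) - 2 * f c
    = (z - x) * (second_diff w c d - C * d ^+ 2).
  by rewrite /f /second_diff; field.
have : (z - x) * (second_diff w c d - C * d ^+ 2) < 0.
  rewrite pmulr_rlt0; last lra.
  have : 0 < (C - K) * d ^+ 2 by rewrite mulr_gt0 ?exprn_gt0//; lra.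
  by rewrite mulrBl; lra.
lra.
Qed.

(** The two bounds control the second divided differences of [w], so the slopes [S x y] and [S x z]
    from a common point differ by at most [C / 2 * |y - z|]. Hence the slopes at [x] converge at a
    linear rate, and the symmetry of [S] makes the limit [C]-Lipschitz. *)
Lemma C11_semiconcave L C w : 0 <= C ->
  semiconcave L C w -> semiconcave L C (fun x => - w x) ->
  C11 0 L w.
Proof.
move=> C0 cw cv.
(* [E] is the numerator of the second divided difference. It is antisymmetric in its three
   arguments, so the bound for ordered triples extends to all triples. *)
pose E x y z := (y - x) * (w z - w x) - (z - x) * (w y - w x).
have Eord x y z : 0 <= x -> x < y -> y < z -> z <= L ->
    `|E x y z| <= C / 2 * (`|z - x| * `|z - y| * `|y - x|).
  move=> x0 xy yz zL.
  rewrite (gtr0_norm (_ : 0 < z - x)) ?(gtr0_norm (_ : 0 < z - y))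
    ?(gtr0_norm (_ : 0 < y - x)); try lra.
  have h1 := cw x y z x0 xy yz zL; have h2 := cv x y z x0 xy yz zL.
  by rewrite ler_norml /E; apply/andP; split; lra.
have E12 x y z : E y x z = - E x y z by rewrite /E; ring.
have E23 x y z : E x z y = - E x y z by rewrite /E; ring.
have Eall x y z : 0 <= x <= L -> 0 <= y <= L -> 0 <= z <= L ->
    `|E x y z| <= C / 2 * (`|z - x| * `|z - y| * `|y - x|).
  have nz (a b : R) : `|a - b| = `|b - a| by rewrite distrC.
  move=> /andP[? ?] /andP[? ?] /andP[? ?].
  have [->|/eqP] := eqVneq x y.
    by rewrite (_ : E y y z = 0) ?normr0 ?subrr ?normr0 ?mulr0//; rewrite /E; ring.
  have [->|/eqP] := eqVneq y z.
    by rewrite (_ : E x z z = 0) ?normr0 ?subrr ?normr0 ?(mulr0, mul0r)//; rewrite /E; ring.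
  have [->|/eqP] := eqVneq x z.
    by rewrite (_ : E z y z = 0) ?normr0 ?subrr ?normr0 ?(mulr0, mul0r)//; rewrite /E; ring.
  move=> /eqP xz /eqP yz /eqP xy.
  have [xy'|xy'] := ltP x y; have [yz'|yz'] := ltP y z; have [xz'|xz'] := ltP x z;
    try (exfalso; lra).
  - exact: Eord.
  - have ? : z < y by rewrite lt_neqAle yz' eq_sym yz.
    rewrite -[E x y z]opprK -E23 normrN; apply: le_trans (Eord _ _ _ _ _ _ _) _ => //.
    by rewrite (nz y z); lra.
  - have ? : z < y by rewrite lt_neqAle yz' eq_sym yz.
    have ? : z < x by rewrite lt_neqAle xz' eq_sym xz.
    rewrite -[E x y z]opprK -E23 normrN -normrN -E12.
    apply: le_trans (Eord _ _ _ _ _ _ _) _ => //.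
    by rewrite (nz y z) (nz x z); lra.
  - have ? : y < x by rewrite lt_neqAle xy' eq_sym xy.
    rewrite -normrN -E12; apply: le_trans (Eord _ _ _ _ _ _ _) _ => //.
    by rewrite (nz y x); lra.
  - have ? : y < x by rewrite lt_neqAle xy' eq_sym xy.
    have ? : z < x by rewrite lt_neqAle xz' eq_sym xz.
    rewrite -normrN -E12 -normrN -E23.
    apply: le_trans (Eord _ _ _ _ _ _ _) _ => //.
    by rewrite (nz y x) (nz x z); lra.
  - have ? : y < x by rewrite lt_neqAle xy' eq_sym xy.
    have ? : z < y by rewrite lt_neqAle yz' eq_sym yz.
    have -> : E x y z = - E z y x by rewrite /E; ring.
    rewrite normrN; apply: le_trans (Eord _ _ _ _ _ _ _) _ => //.
    by rewrite (nz y x) (nz x z) (nz y z); lra.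
pose S x y := (w y - w x) / (y - x).
have SL x y z : 0 <= x <= L -> 0 <= y <= L -> 0 <= z <= L -> y != x -> z != x ->
    S x y - S x z <= C / 2 * `|y - z|.
  move=> hx hy hz yx zx.
  have hE := Eall x y z hx hy hz.
  have y0 : y - x != 0 by rewrite subr_eq0.
  have z0 : z - x != 0 by rewrite subr_eq0.
  have SE : S x y - S x z = - E x y z / ((y - x) * (z - x)).
    by rewrite /S /E; field; rewrite y0 z0.
  apply: le_trans (ler_norm _) _.
  rewrite SE normrM normrN normfV normrM.
  rewrite ler_pdivrMr ?mulr_gt0 ?normr_gt0//.
  by apply: le_trans hE _; rewrite (distrC z y); lra.
(* The derivative is a supremum of lower bounds instead of a limit: each [S x y - C / 2 * |y - x|]
   lies below every [S x z + C / 2 * |z - x|]. The same definition serves at the endpoints. *)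
pose A x := [set s | exists y, [/\ 0 <= y <= L, y != x & s = S x y - C / 2 * `|y - x|]].
pose g x := sup (A x).
have gS x y : 0 <= x <= L -> 0 <= y <= L -> y != x ->
    `|g x - S x y| <= C / 2 * `|y - x|.
  move=> hx hy yx.
  have ub z : 0 <= z <= L -> z != x -> ubound (A x) (S x z + C / 2 * `|z - x|).
    move=> hz zx s [t [ht tx ->]].
    have h1 := SL x t z hx ht hz tx zx.
    have h2 : C / 2 * `|t - z| <= C / 2 * (`|t - x| + `|z - x|).
      by apply: ler_wpM2l; [lra|rewrite (distrC z x) ler_distD].
    by rewrite mulrDr in h2; lra.
  have Ay : A x (S x y - C / 2 * `|y - x|) by exists y.
  have h1 : g x <= S x y + C / 2 * `|y - x|.
    by apply: ge_sup; [exists (S x y - C / 2 * `|y - x|)|exact: ub].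
  have h2 : S x y - C / 2 * `|y - x| <= g x.
    by apply: ub_le_sup => //; exists (S x y + C / 2 * `|y - x|); exact: ub.
  by rewrite ler_norml; apply/andP; split; lra.
exists g; split.
  move=> x; rewrite in_itv/= => hx.
  apply/cvgrPdist_le => e e0.
  rewrite near_withinE /dnbhs near_withinE; near=> y => yx; rewrite /= in_itv/= => hy.
  apply: le_trans (gS x y _ _ _) _ => //.
  (* The [+ 1] keeps the denominator positive when [C = 0]. *)
  have yd : `|y - x| <= e / (C / 2 + 1).
    rewrite distrC; near: y; apply/nbhs_ballP.
    by exists (e / (C / 2 + 1)) => /= [|y /ltW//]; rewrite divr_gt0//; lra.
  have C20 : 0 < C / 2 + 1 by lra.
  rewrite -(ler_pM2l C20) in yd.
  have : (C / 2 + 1) * (e / (C / 2 + 1)) = e by rewrite mulrC divfK// gt_eqF.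
  have := normr_ge0 (y - x); lra.
have gg x y : 0 <= x <= L -> 0 <= y <= L -> `|g x - g y| <= C * `|x - y|.
  move=> hx hy; have [->|xy] := eqVneq x y.
    by rewrite !subrr normr0 mulr0.
  have h1 := gS x y hx hy; have h2 := gS y x hy hx xy.
  rewrite eq_sym in h1; have {}h1 := h1 xy.
  have SE : S x y = S y x by rewrite /S -(opprB (w x)) -(opprB x) invrN mulrNN.
  have := ler_distD (S x y) (g x) (g y).
  by rewrite (distrC (S x y)) {2}SE; rewrite (distrC y x) in h1; lra.
exists C; split; first by rewrite ger0_real.
move=> M CM [x y] /= []; rewrite !in_itv/= => hx hy.
apply: le_trans (gg x y hx hy) _.
by apply: ler_wpM2r => //; exact: ltW.
Unshelve. all: by end_near.
Qed.
End semiconcave.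

(** * Smooth functions and mollifiers *)

Definition smooth {R : realType} (f : R -> R) : Prop :=
  forall n x, derivable (derive1n n f) x 1.

Section smooth.
Context {R : realType}.
Implicit Types f g : R -> R.

Lemma is_derive_derive1 f f' : (forall x : R, is_derive x 1 f (f' x)) -> derive1 f = f'.
Proof. by move=> h; apply/funext => x; rewrite derive1E; apply: derive_val. Qed.

(** Coinduction principle: a class of functions stable under differentiation contains only smooth
    functions. It spares every closed formula for an [n]-th derivative. *)
Lemma smooth_coind (P : (R -> R) -> Prop) :
  (forall f, P f -> exists2 f', P f' & forall x : R, is_derive x 1 f (f' x)) ->
  forall f, P f -> smooth f.
Proof.
move=> hP f Pf n.
have : P (derive1n n f).
  elim: n => [//|n /hP[f' Pf' df]].
  by rewrite derive1nS (is_derive_derive1 df).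
by move=> /hP[f' _ df] x; apply: ex_derive.
Qed.

Lemma smooth_derive1 f : smooth f -> smooth (derive1 f).
Proof. by move=> sf n x; rewrite -derive1Sn. Qed.

Lemma smooth_is_derive f : smooth f -> forall x : R, is_derive x 1 f (derive1 f x).
Proof. by move=> sf x; apply: DeriveDef; [exact: (sf 0%N)|rewrite derive1E]. Qed.

Lemma smooth_antiderivative f f' :
  (forall x : R, is_derive x 1 f (f' x)) -> smooth f' -> smooth f.
Proof.
move=> df sf' [|n] x; first by apply: ex_derive.
by rewrite derive1Sn (is_derive_derive1 df); exact: sf'.
Qed.

(** By the Leibniz rule this closure is stable under differentiation, which is what [smooth_coind]
    asks for. *)
Inductive smooth_ring : (R -> R) -> Prop :=
| smooth_ring_base f : smooth f -> smooth_ring f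
| smooth_ring_add f g : smooth_ring f -> smooth_ring g ->
    smooth_ring (fun x => f x + g x)
| smooth_ring_mul f g : smooth_ring f -> smooth_ring g ->
    smooth_ring (fun x => f x * g x).

Lemma smooth_ring_smooth f : smooth_ring f -> smooth f.
Proof.
apply: smooth_coind => {}f; elim => {f}.
- move=> f sf; exists (derive1 f); last exact: smooth_is_derive.
  by apply: smooth_ring_base; exact: smooth_derive1.
- move=> f g sf [f' sf' df] sg [g' sg' dg].
  by exists (fun x => f' x + g' x); [exact: smooth_ring_add|move=> x; exact: is_deriveD].
- move=> f g sf [f' sf' df] sg [g' sg' dg].
  exists (fun x => f x * g' x + g x * f' x); last by move=> x; exact: is_deriveM.
  by apply: smooth_ring_add; exact: smooth_ring_mul.
Qed.

Lemma smoothD f g : smooth f -> smooth g -> smooth (fun x => f x + g x).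
Proof.
by move=> sf sg; apply/smooth_ring_smooth/smooth_ring_add; exact: smooth_ring_base.
Qed.

Lemma smoothM f g : smooth f -> smooth g -> smooth (fun x => f x * g x).
Proof.
by move=> sf sg; apply/smooth_ring_smooth/smooth_ring_mul; exact: smooth_ring_base.
Qed.

Lemma smooth_affine f a b c : smooth f -> smooth (fun x => c * f (a * x + b)).
Proof.
move=> sf; apply: (@smooth_coind (fun h => exists f a b c, smooth f /\
  h = fun x => c * f (a * x + b))); last by exists f, a, b, c.
move=> _ {f a b c sf} [f [a [b [c [sf ->]]]]].
exists (fun x => (c * a) * derive1 f (a * x + b)).
  by exists (derive1 f), a, b, (c * a); split => //; exact: smooth_derive1.
move=> x.
have dl : is_derive x 1 (fun y : R => a * y + b) a.
  by apply: is_derive_eq; rewrite addr0 /GRing.scale /= mulr1.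
have df := smooth_is_derive sf (a * x + b).
have := is_derive1_comp (f := f) (g := fun y : R => a * y + b) df dl.
move=> dc.
apply: (is_derive_eq (is_deriveZ c dc : is_derive x 1 (fun y : R => c * f (a * y + b)) _)).
by rewrite /GRing.scale /=; ring.
Qed.

Lemma smoothZ f c : smooth f -> smooth (fun x => c * f x).
Proof.
move=> /(@smooth_affine f 1 0 c); congr smooth.
by apply/funext => x; rewrite mul1r addr0.
Qed.

Lemma smooth_continuous f : smooth f -> continuous f.
Proof.
by move=> sf x; apply: differentiable_continuous; apply/derivable1_diffP; exact: (sf 0%N).
Qed.

(** * Flat functions, primitives and the standard mollifier *)

Definition flat (n : nat) (x : R) : R :=
  if 0 < x then x^-1 ^+ n * expR (- x^-1) else 0.

Lemma flat_ge0 n x : 0 <= flat n x.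
Proof.
rewrite /flat; case: ifPn => // x0.
by rewrite mulr_ge0 ?expR_ge0 ?exprn_ge0 ?invr_ge0 // ltW.
Qed.

(** The exponential of [y = 1 / x] dominates [y^(n+2) / (n+2)!]. The two spare powers leave a factor
    [x^2], enough for a zero derivative at the origin. *)
Lemma flat_le n x : flat n x <= n.+2`!%:R * `|x| ^+ 2.
Proof.
rewrite /flat; case: ifPn => x0; last by rewrite mulr_ge0 ?sqr_ge0.
rewrite (gtr0_norm x0) expRN ler_pdivrMr ?expR_gt0//.
have y0 : 0 < x^-1 by rewrite invr_gt0.
have h := expR_ge1Dxn n.+1 (ltW y0).
have {}h : x^-1 ^+ n.+2 / n.+2`!%:R <= expR x^-1 by lra.
have f0 : (0 : R) < n.+2`!%:R by rewrite ltr0n fact_gt0.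
have -> : x^-1 ^+ n = n.+2`!%:R * x ^+ 2 * (x^-1 ^+ n.+2 / n.+2`!%:R).
  rewrite !exprS; field; rewrite gt_eqF //= gt_eqF//.
by rewrite ler_wpM2l// mulr_ge0// ?sqr_ge0 // ltW.
Qed.

(** Away from 0 this is the derivative of [x^(-n) exp(-1/x)] or of 0; at 0 the difference quotient
    is at most [(n+2)! |h|] by [flat_le]. *)
Lemma flat_is_derive n (x : R) :
  is_derive x 1 (flat n) (- n%:R * flat n.+1 x + flat n.+2 x).
Proof.
have [x0|x0|->] := ltgtP x 0.
- rewrite /flat ltNge (ltW x0) /= mulr0 addr0.
  apply: (@near_eq_is_derive _ _ _ (cst 0)).
  by near=> y; rewrite ifF //; apply/negbTE; rewrite -leNgt ltW //=; near: y; exact: lt_nbhsl.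
- have xn0 : x != 0 by rewrite gt_eqF.
  apply: (@near_eq_is_derive _ _ _ (fun y : R => y^-1 ^+ n * expR (- y^-1))).
    by near=> y; rewrite /flat ifT //; near: y; exact: lt_nbhsr.
  rewrite /flat x0.
  have dV : is_derive x 1 (fun y : R => y^-1) (- x ^- 2).
    by apply: (is_derive_eq (@is_deriveV _ id x 1 1 xn0 _)); rewrite /GRing.scale /= mulr1.
  have dE : is_derive x 1 (fun y : R => expR (- y^-1)) (expR (- x^-1) * x ^- 2).
    have dN : is_derive x 1 (fun y : R => - y^-1) (x ^- 2).
      by apply: (is_derive_eq (is_deriveN dV)); rewrite opprK.
    exact: (@is_derive1_comp _ expR (fun y : R => - y^-1) x _ _ (is_derive_expR _) dN).
  have dX : is_derive x 1 (fun y : R => y^-1 ^+ n) (n%:R * x^-1 ^+ n.-1 * - x ^- 2).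
    have -> : (fun y : R => y^-1 ^+ n) = (fun y : R => y^-1) ^+ n.
      by apply/funext => y; rewrite fctE.
    by apply: is_derive_eq; rewrite /GRing.scale /=.
  apply: (is_derive_eq (is_deriveM dX dE :
    is_derive x 1 (fun y => y^-1 ^+ n * expR (- y^-1)) _)); rewrite /GRing.scale /=.
  case: n {dX} => [|n] /=; rewrite -?exprVn !exprS ?expr0; ring.
- rewrite /flat ltxx mulr0 addr0.
  have cv : h^-1 *: (flat n (h *: 1 + 0) - flat n 0) @[h --> (0 : R)^'] --> (0 : R).
    apply/cvgrPdist_le => e e0.
    rewrite /dnbhs near_withinE; near=> h => h0.
    rewrite sub0r normrN /GRing.scale/= mulr1 addr0 {2}/flat ltxx subr0.
    rewrite normrM normfV ger0_norm ?flat_ge0// mulrC ler_pdivrMr ?normr_gt0//.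
    apply: le_trans (flat_le n h) _; rewrite expr2 mulrA ler_wpM2r//.
    have hd : `|h| <= e / n.+2`!%:R.
      near: h; apply/nbhs_ballP; exists (e / n.+2`!%:R) => /=.
        by rewrite divr_gt0// ltr0n fact_gt0.
      by move=> y; rewrite /ball/= sub0r normrN => /ltW.
    by move: hd; rewrite ler_pdivlMr ?ltr0n ?fact_gt0// mulrC.
  by apply: DeriveDef; [apply/cvg_ex; exists 0|exact: cvg_lim cv].
Unshelve. all: by end_near.
Qed.


(* By [flat_is_derive] this span is stable under differentiation. *)
Inductive flat_span : (R -> R) -> Prop :=
| flat_span_flat a n : flat_span (fun x => a * flat n x)
| flat_span_add f g : flat_span f -> flat_span g -> flat_span (fun x => f x + g x).

Lemma smooth_flat n : smooth (flat n).
Proof.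
have -> : flat n = fun x => 1 * flat n x by apply/funext => x; rewrite mul1r.
apply: (@smooth_coind flat_span); last exact: flat_span_flat.
move=> f; elim => {f}.
- move=> a m; exists (fun x => - (a * m%:R) * flat m.+1 x + a * flat m.+2 x).
    by apply: flat_span_add; exact: flat_span_flat.
  move=> x; apply: (is_derive_eq (is_deriveZ a (flat_is_derive m x) :
    is_derive x 1 (fun y : R => a * flat m y) _)).
  by rewrite /GRing.scale /=; ring.
- move=> f g sf [f' sf' df] sg [g' sg' dg].
  by exists (fun x => f' x + g' x); [exact: flat_span_add|move=> x; exact: is_deriveD].
Qed.

(** The primitive is taken from minus infinity. Since [f] vanishes on the left, integrability
    reduces to a compact interval and the primitive vanishes there too. *)
Lemma continuous_antiderivative f : continuous f ->
  (forall x, x <= 0 -> f x = 0) ->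
  exists2 F : R -> R, forall x : R, is_derive x 1 F (f x) &
    forall x, x <= 0 -> F x = 0.
Proof.
move=> cf f0.
exists (fun x => \int[lebesgue_measure]_(t in [set` `]-oo, x]]) f t); last first.
  move=> x x0; rewrite (@eq_Rintegral _ _ _ _ _ (cst 0)); first by rewrite Rintegral_cst// mul0r.
  by move=> t; rewrite inE/= in_itv/= => tx; rewrite f0// (le_trans tx).
move=> x.
have xu : x < Num.max x 0 + 1.
  by rewrite ltr_pwDr// le_max lexx.
have [||/=] := @continuous_FTC1 R f -oo%O x (Num.max x 0 + 1) xu _ _ (cf x).
- apply/integrable_mkcond => //.
  rewrite (_ : _ \_ _ = (EFin \o f) \_ `[0, Num.max x 0 + 1]%classic).
    apply: (integrable_mkcond _ _).1 => //.
    apply: continuous_compact_integrable; first exact: segment_compact.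
    exact: continuous_subspaceT.
  apply/funext => t; rewrite !patchE !mem_setE !in_itv/=.
  by have [//|/ltW/f0 /= ->] := leP 0 t; rewrite if_same.
- exact: ltNyr.
- by move=> dF FE; apply: (DeriveDef dF); rewrite -derive1E FE.
Qed.

(* [ramp'' = rho] with [rho >= 0] of mass 1 supported in [0, 1], so that second
   differences of translates of [ramp] are nonnegative test functions. *)
Record mollifier (rho step ramp : R -> R) : Prop := Mollifier {
  mollifier_smooth : smooth rho;
  mollifier_step : forall x : R, is_derive x 1 step (rho x);
  mollifier_ramp : forall x : R, is_derive x 1 ramp (step x);
  mollifier_ge0 : forall x, 0 <= rho x;
  mollifier_out : forall x, x <= 0 \/ 1 <= x -> rho x = 0;
  step_le0 : forall x, x <= 0 -> step x = 0;
  step_ge1 : forall x, 1 <= x -> step x = 1;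
  ramp_le0 : forall x, x <= 0 -> ramp x = 0;
  ramp_ge1 : forall x, 1 <= x -> ramp x = x - 1 + ramp 1 }.

Lemma is_derive_continuous f f' : (forall x : R, is_derive x 1 f (f' x)) -> continuous f.
Proof.
move=> df x; apply: differentiable_continuous; apply/derivable1_diffP.
exact: ex_derive.
Qed.

Lemma mean_value f f' a b : a < b -> (forall x : R, is_derive x 1 f (f' x)) ->
  exists c, [/\ a < c, c < b & f b - f a = f' c * (b - a)].
Proof.
move=> ab df.
have [|c + fE] := @MVT _ f f' a b ab (fun x _ => df x).
  by apply: continuous_subspaceT; exact: is_derive_continuous df.
by rewrite in_itv/= => /andP[ac cb]; exists c.
Qed.

(** The bump [exp(-1/x) exp(-1/(1-x))] on (0, 1) is divided by its mass [F 1] and integrated twice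
    from the left. The mass is positive because, by the mean value theorem, it is a value of the
    bump inside (0, 1). *)
Lemma mollifier_exists : exists rho step ramp : R -> R, mollifier rho step ramp.
Proof.
pose b x : R := flat 0 x * flat 0 (1 - x).
have sb : smooth b.
  apply: smoothM; first exact: smooth_flat.
  have := @smooth_affine (flat 0) (-1) 1 1 (@smooth_flat 0); congr smooth.
  by apply/funext => x; rewrite mul1r; congr (flat 0 _); ring.
have b_le0 x : x <= 0 -> b x = 0.
  by move=> x0; rewrite /b /flat ltNge x0 /= mul0r.
have b_ge1 x : 1 <= x -> b x = 0.
  by move=> x1; rewrite /b /flat (_ : 0 < 1 - x = false) ?mulr0//; apply/negbTE; lra.
have b_gt0 x : 0 < x -> x < 1 -> 0 < b x.
  move=> x0 x1; rewrite /b /flat !ifT; try lra.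
  by rewrite !expr0 !mul1r mulr_gt0 ?expR_gt0.
have [F dF F0] := continuous_antiderivative (smooth_continuous sb) b_le0.
have F10 : 0 < F 1.
  have [c [c0 c1]] := mean_value ltr01 dF.
  by rewrite (F0 0)// !subr0 mulr1 => ->; exact: b_gt0.
have dstep (x : R) : is_derive x 1 (fun y : R => (F 1)^-1 * F y) ((F 1)^-1 * b x).
  exact: is_deriveZ.
have F_ge1 x : 1 <= x -> F x = F 1.
  rewrite le_eqVlt => /predU1P[<-//|x1].
  have [c [c0 c1]] := mean_value x1 dF.
  by rewrite b_ge1 ?mul0r; lra.
have s0 x : x <= 0 -> (F 1)^-1 * F x = 0 by move=> x0; rewrite (F0 x)// mulr0.
have s1 x : 1 <= x -> (F 1)^-1 * F x = 1.
  by move=> x1; rewrite (F_ge1 x)// mulVf// gt_eqF.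
have [G dG G0] := continuous_antiderivative (is_derive_continuous dstep) s0.
exists (fun x => (F 1)^-1 * b x), (fun x => (F 1)^-1 * F x), G; split => //.
- exact: smoothZ.
- move=> x; apply: mulr_ge0; first by rewrite invr_ge0 ltW.
  by rewrite /b mulr_ge0// flat_ge0.
- by move=> x [/b_le0|/b_ge1] ->; rewrite mulr0.
- move=> x; rewrite le_eqVlt => /predU1P[<-|x1]; first by ring.
  have [c [c0 c1 h]] := mean_value x1 dG.
  by rewrite (s1 c (ltW c0)) mul1r in h; lra.
Qed.

Lemma step_nondecreasing rho step ramp : mollifier rho step ramp ->
  {homo step : x y / x <= y}.
Proof.
move=> m x y; rewrite le_eqVlt => /predU1P[->//|xy].
have [c [_ _ h]] := mean_value xy (mollifier_step m).
rewrite -subr_ge0 h mulr_ge0//; first exact: mollifier_ge0 m _.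
by rewrite subr_ge0 ltW.
Qed.

(** The derivative [step] is nondecreasing; the mean value theorem on both sides of [c] compares two
    of its values. *)
Lemma ramp_convex rho step ramp c d : mollifier rho step ramp -> 0 < d ->
  0 <= second_diff ramp c d.
Proof.
move=> m d0.
have h1 : c < c + d by lra.
have h2 : c - d < c by lra.
have [a [a1 a2 ha]] := mean_value h1 (mollifier_ramp m).
have [b [b1 b2 hb]] := mean_value h2 (mollifier_ramp m).
rewrite /second_diff.
have sba : step b <= step a by apply: (step_nondecreasing m); lra.
have -> : ramp (c + d) + ramp (c - d) - 2 * ramp c = (step a - step b) * d.
  have -> : (step a - step b) * d = step a * (c + d - c) - step b * (c - (c - d)) by ring.
  by rewrite -ha -hb; ring.
by rewrite mulr_ge0 ?subr_ge0// ltW.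
Qed.

End smooth.

(** * Integration on the interval *)

Definition itg {R : realType} (L : R) (f : R -> R) : Prop :=
  (@lebesgue_measure R).-integrable `]0, L[ (EFin \o f).

Definition bdd_mfun {R : realType} (L : R) (f : R -> R) : Prop :=
  measurable_fun `]0, L[ f /\ exists M : R, forall x, 0 < x -> x < L -> `|f x| <= M.

Section integrals.
Context {R : realType} (L : R).
Implicit Types f g w : R -> R.
Local Notation mu := (@lebesgue_measure R).
Local Notation I := (`]0, L[%classic : set R).

Let mI : measurable (I : set (measurableTypeR R)). Proof. exact: measurable_itv. Qed.

Let muI : (mu I < +oo)%E.
Proof. by rewrite lebesgue_measure_itv/=; case: ifPn => _; rewrite -?EFinB ltry. Qed.

Lemma itgD f g : itg L f -> itg L g -> itg L (fun x => f x + g x).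
Proof. by move=> fi gi; exact: (integrableD mI fi gi). Qed.

Lemma itgZ (a : R) f : itg L f -> itg L (fun x => a * f x).
Proof. by move=> fi; exact: (integrableZl mI a fi). Qed.

Lemma itgM f g : bdd_mfun L f -> itg L g -> itg L (fun x => f x * g x).
Proof.
move=> [mf [M fM]] gi.
apply: (@integrableMr _ _ _ _ _ mI f (EFin \o g)) => //.
exists M; split; first exact: num_real.
move=> N MN x /=; rewrite in_itv/= => /andP[x0 xL].
by apply: le_trans (fM x x0 xL) _; exact: ltW.
Qed.

Lemma bdd_itg f : bdd_mfun L f -> itg L f.
Proof.
move=> [mf [M fM]]; apply: (measurable_bounded_integrable mI muI mf).
exists M; split; first exact: num_real.
move=> N MN x /=; rewrite in_itv/= => /andP[x0 xL].
by apply: le_trans (fM x x0 xL) _; exact: ltW.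
Qed.

Lemma bddD f g : bdd_mfun L f -> bdd_mfun L g -> bdd_mfun L (fun x => f x + g x).
Proof.
move=> [mf [M fM]] [mg [N gN]]; split; first exact: measurable_funD.
exists (M + N) => x x0 xL; apply: le_trans (ler_normD _ _) _.
by rewrite lerD ?fM ?gN.
Qed.

Lemma bddM f g : bdd_mfun L f -> bdd_mfun L g -> bdd_mfun L (fun x => f x * g x).
Proof.
move=> [mf [M fM]] [mg [N gN]]; split; first exact: measurable_funM.
exists (M * N) => x x0 xL; rewrite normrM.
by apply: ler_pM => //; [exact: fM|exact: gN].
Qed.

Lemma bdd_cst a : bdd_mfun L (fun=> a).
Proof. by split; [exact: measurable_cst|exists `|a|]. Qed.

Lemma bddZ a f : bdd_mfun L f -> bdd_mfun L (fun x => a * f x).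
Proof. exact: bddM (bdd_cst a). Qed.

Lemma bdd_continuous f : {within `[0, L], continuous f} -> bdd_mfun L f.
Proof.
move=> cf; split.
  apply: (@measurable_funS _ _ _ _ `[0, L]%classic) => //.
    by apply: subset_itv; rewrite bnd_simp.
  by apply: subspace_continuous_measurable_fun.
have [L0|L0] := leP 0 L; last by exists 0 => x; lra.
have [a _ amax] := EVT_max L0 cf; have [b _ bmin] := EVT_min L0 cf.
exists (`|f a| + `|f b|) => x x0 xL.
have xI : x \in `[0, L] by rewrite in_itv/= !ltW.
have := amax x xI; have := bmin x xI.
have := ler_norm (f a); have := ler_norm (- f b); rewrite normrN.
have := normr_ge0 (f a); have := normr_ge0 (f b).
by move=> *; rewrite ler_norml; apply/andP; split; lra.
Qed.

(** The product is dominated by [f^2 + g^2]. *)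
Lemma L2_mulM f g : L2 L f -> L2 L g -> itg L (fun x => f x * g x).
Proof.
move=> [mf fi] [mg gi].
apply: (le_integrable mI _ _ (integrableD mI fi gi)).
  by apply/measurable_EFinP; exact: measurable_funM.
move=> x _ /=; rewrite lee_fin.
rewrite [leRHS]ger0_norm ?addr_ge0 ?sqr_ge0//.
have := sqr_ge0 (f x + g x); have := sqr_ge0 (f x - g x).
have := sqr_ge0 (f x); have := sqr_ge0 (g x).
by rewrite !expr2 => *; rewrite ler_norml; apply/andP; split; lra.
Qed.

Lemma bdd_L2 f : bdd_mfun L f -> L2 L f.
Proof.
move=> bf; split; first exact: bf.1.
have := bdd_itg (bddM bf bf); congr integrable.
Qed.

Lemma L2_itg f : L2 L f -> itg L f.
Proof.
move=> fi; have := L2_mulM fi (bdd_L2 (bdd_cst 1)); congr itg.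
by apply/funext => x; rewrite mulr1.
Qed.

Lemma L2D f g : L2 L f -> L2 L g -> L2 L (fun x => f x + g x).
Proof.
move=> fi gi; split; first exact: measurable_funD fi.1 gi.1.
have h := itgD (itgD (L2_mulM fi fi) (itgZ 2 (L2_mulM fi gi))) (L2_mulM gi gi).
move: h; congr integrable.
by apply/funext => x /=; congr EFin; ring.
Qed.

Lemma Rintegral_ae_eq f g : itg L f -> itg L g ->
  {ae mu, forall x, I x -> f x = g x} ->
  \int[mu]_(x in I) f x = \int[mu]_(x in I) g x.
Proof.
move=> fi gi fg; rewrite /Rintegral; congr fine.
apply: ae_eq_integral => //; [exact: measurable_int fi|exact: measurable_int gi|].
apply: filterS fg; first exact: (ae_filter_ringOfSetsType mu).
by move=> x h /h /= ->.
Qed.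

End integrals.

(** * Test functions: supports and integration by parts *)

Section test_functions.
Context {R : realType} (L : R).
Implicit Types f g w : R -> R.
Local Notation mu := (@lebesgue_measure R).
Local Notation I := (`]0, L[%classic : set R).

Lemma supp_out f x : ~ supp f x -> f x = 0.
Proof.
move=> nfx; apply/eqP; apply: contrapT => /negP fx.
by apply: nfx; exact: subset_closure.
Qed.

(** Off the closed set [supp f] the function is locally zero, and so is its derivative. *)
Lemma supp_derive1 f : supp (derive1 f) `<=` supp f.
Proof.
have -> : supp f = closure (supp f) by apply/closure_id; exact: closed_closure.
apply: closure_subset => x /= f'x; apply: contrapT => nx.
move/eqP: f'x; apply.
have nf : \forall y \near x, f y = cst 0 y.
  have : open (~` supp f) by apply: closed_openC; exact: closed_closure.
  rewrite openE => /(_ x nx); apply: filterS => y /=; exact: supp_out.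
by rewrite derive1E (near_eq_derive _ nf) derive_cst.
Qed.

Lemma test_smooth f : test_fun L f -> smooth f.
Proof. by case. Qed.

Lemma test_derive1 f : test_fun L f -> test_fun L (derive1 f).
Proof.
move=> [sf If]; split; first exact: smooth_derive1.
by apply: subset_trans If; exact: supp_derive1.
Qed.

Lemma test_out f x : test_fun L f -> x <= 0 \/ L <= x -> f x = 0.
Proof.
move=> [_ If] xI; apply: supp_out => /If /=; rewrite in_itv/= => /andP[].
by case: xI; lra.
Qed.

Lemma supp_itv f a b : (forall x, x < a \/ b < x -> f x = 0) ->
  supp f `<=` `[a, b].
Proof.
move=> f0; have /closure_id -> : closed (`[a, b]%classic : set R) by exact: interval_closed.
apply: closure_subset => x /= /eqP fx; rewrite in_itv/=.
by apply/andP; split; rewrite leNgt; apply/negP => h; apply: fx; apply: f0; lra.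
Qed.

Lemma smooth_bdd f : smooth f -> bdd_mfun L f.
Proof.
move=> sf; apply: bdd_continuous; apply: continuous_subspaceT.
exact: smooth_continuous.
Qed.

Lemma test_bdd f : test_fun L f -> bdd_mfun L f.
Proof. by move=> tf; exact/smooth_bdd/test_smooth. Qed.

Lemma Rintegral_derive f f' : 0 < L -> (forall x : R, is_derive x 1 f (f' x)) ->
  continuous f' -> \int[mu]_(x in I) f' x = f L - f 0.
Proof.
move=> L0 df cf'.
have fi : mu.-integrable `[0, L]%classic (EFin \o f').
  apply: continuous_compact_integrable; first exact: segment_compact.
  exact: continuous_subspaceT.
have ioc : I `<=` `[0, L[ by apply: subset_itv; rewrite bnd_simp.
have icc : `[0, L[ `<=` `[0, L] by apply: subset_itv; rewrite bnd_simp.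
rewrite Rintegral_itv_obnd_cbnd; last first.
  by apply: integrableS fi => //; exact: subset_trans ioc icc.
rewrite Rintegral_itv_bndo_bndc; last exact: integrableS fi.
have cf := is_derive_continuous df.
rewrite /Rintegral (@continuous_FTC2 _ _ f)//.
- exact: continuous_subspaceT.
- split; [by move=> x _; exact: ex_derive|exact: cvg_at_right_filter (cf 0)|].
  exact: cvg_at_left_filter (cf L).
- by move=> x _; rewrite (is_derive_derive1 df).
Qed.

Lemma test_by_parts f g : 0 < L -> smooth f -> test_fun L g ->
  \int[mu]_(x in I) (f x * derive1 g x) = - \int[mu]_(x in I) (derive1 f x * g x).
Proof.
move=> L0 sf tg; have sg := test_smooth tg.
have mI : measurable (I : set (measurableTypeR R)) by exact: measurable_itv.
have d (x : R) : is_derive x 1 (fun y => f y * g y) (f x * derive1 g x + derive1 f x * g x).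
  apply: (is_derive_eq (is_deriveM (smooth_is_derive sf x) (smooth_is_derive sg x))).
  by rewrite /GRing.scale /= [X in _ + X]mulrC.
have sf' := smooth_derive1 sf; have sg' := smooth_derive1 sg.
have bf := smooth_bdd sf; have bg := smooth_bdd sg.
have bf' := smooth_bdd sf'; have bg' := smooth_bdd sg'.
have := Rintegral_derive L0 d (smooth_continuous (smoothD (smoothM sf sg') (smoothM sf' sg))).
rewrite (test_out (x := L) tg) ?(test_out (x := 0) tg); [|by left|by right].
rewrite !mulr0 subrr (RintegralD mI (bdd_itg (bddM bf bg')) (bdd_itg (bddM bf' bg))).
by move/eqP; rewrite addr_eq0 => /eqP.
Qed.

End test_functions.

(** * Rescaled mollifiers as approximate identities *)

Section mollification.
Context {R : realType} (L : R) (rho step ramp : R -> R).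
Hypothesis mol : mollifier rho step ramp.
Implicit Types f g w m : R -> R.
Local Notation mu := (@lebesgue_measure R).
Local Notation I := (`]0, L[%classic : set R).

Definition rescale f (h p x : R) : R := f (h^-1 * x + - (h^-1 * p)).

(** A one-sided approximate identity at [p]: for [h > 0] it is carried by [[p, p + h]], to the right
    of [p]. *)
Definition kern (h p x : R) : R := h^-1 * rescale rho h p x.

Let mI : measurable (I : set (measurableTypeR R)). Proof. exact: measurable_itv. Qed.

Lemma smooth_step : smooth step.
Proof. exact: smooth_antiderivative (mollifier_step mol) (mollifier_smooth mol). Qed.

Lemma smooth_ramp : smooth ramp.
Proof. exact: smooth_antiderivative (mollifier_ramp mol) smooth_step. Qed.

Lemma smooth_rescale f h p : smooth f -> smooth (rescale f h p).
Proof.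
move=> sf; have := @smooth_affine _ f h^-1 (- (h^-1 * p)) 1 sf; congr smooth.
by apply/funext => x; rewrite mul1r.
Qed.

Lemma smooth_kern h p : smooth (kern h p).
Proof. exact/smoothZ/smooth_rescale/(mollifier_smooth mol). Qed.

Lemma is_derive_rescale f f' h p : (forall x : R, is_derive x 1 f (f' x)) ->
  forall x : R, is_derive x 1 (rescale f h p) (h^-1 * rescale f' h p x).
Proof.
move=> df x.
have dl : is_derive x 1 (fun y : R => h^-1 * y + - (h^-1 * p)) h^-1.
  by apply: is_derive_eq; rewrite oppr0 addr0 /GRing.scale /= mulr1.
apply: (is_derive_eq (is_derive1_comp (f := f)
  (g := fun y : R => h^-1 * y + - (h^-1 * p)) (df _) dl)).
by rewrite mulrC.
Qed.

Lemma rescale_arg_le0 (h p x : R) : 0 < h -> x <= p -> h^-1 * x + - (h^-1 * p) <= 0.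
Proof. by move=> h0 xp; rewrite -mulrBr pmulr_rle0 ?invr_gt0// subr_le0. Qed.

Lemma rescale_arg_ge1 (h p x : R) : 0 < h -> p + h <= x -> 1 <= h^-1 * x + - (h^-1 * p).
Proof.
by move=> h0 xp; rewrite -mulrBr -(mulVf (_ : h != 0)) ?gt_eqF// ler_pM2l ?invr_gt0//; lra.
Qed.

Lemma kern_ge0 h p x : 0 < h -> 0 <= kern h p x.
Proof.
move=> h0; rewrite /kern /rescale mulr_ge0 ?invr_ge0 ?(ltW h0)//.
exact: (mollifier_ge0 mol).
Qed.

Lemma kern_out h p x : 0 < h -> x <= p \/ p + h <= x -> kern h p x = 0.
Proof.
move=> h0 xp; rewrite /kern /rescale (mollifier_out mol) ?mulr0//.
by case: xp => ?; [left; exact: rescale_arg_le0|right; exact: rescale_arg_ge1].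
Qed.

Lemma kern_bdd h p : bdd_mfun L (kern h p).
Proof. exact/smooth_bdd/smooth_kern. Qed.

Lemma kern_mass h p : 0 < h -> 0 <= p -> p + h <= L -> \int[mu]_(x in I) kern h p x = 1.
Proof.
move=> h0 p0 pL; have L0 : 0 < L by lra.
have dS := is_derive_rescale h p (mollifier_step mol).
rewrite (Rintegral_derive L0 dS (smooth_continuous (@smooth_kern h p))).
rewrite /rescale (step_ge1 mol); last exact: rescale_arg_ge1.
by rewrite (step_le0 mol) ?subr0//; exact: rescale_arg_le0.
Qed.

Lemma kern_center h p m : itg L m -> 0 < h -> 0 <= p -> p + h <= L ->
  \int[mu]_(x in I) (kern h p x * m x) - m p =
  \int[mu]_(x in I) (kern h p x * (m x + - m p)).
Proof.
move=> mi h0 p0 pL.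
under [RHS]eq_Rintegral do rewrite mulrDr.
rewrite RintegralD//; last 2 first.
- exact: itgM (kern_bdd _ _) mi.
- exact: itgM (kern_bdd _ _) (bdd_itg (bdd_cst _ _)).
rewrite RintegralZr//; last exact/bdd_itg/kern_bdd.
by rewrite kern_mass// mul1r.
Qed.

Lemma kern_continuous h p d w : bdd_mfun L w -> 0 < h -> 0 <= p -> p + h <= L ->
  (forall x, p <= x -> x <= p + h -> `|w x - w p| <= d) ->
  `|\int[mu]_(x in I) (kern h p x * w x) - w p| <= d.
Proof.
move=> bw h0 p0 pL wd.
rewrite kern_center//; last exact: bdd_itg.
have bk := bddM (kern_bdd h p) (bddD bw (bdd_cst L (- w p))).
apply: le_trans (le_normr_Rintegral mI (bdd_itg bk)) _.
have -> : d = \int[mu]_(x in I) (kern h p x * d).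
  by rewrite RintegralZr ?kern_mass ?mul1r//; exact/bdd_itg/kern_bdd.
apply: le_Rintegral => //.
- exact: (integrable_norm (bdd_itg bk)).
- exact: itgM (kern_bdd _ _) (bdd_itg (bdd_cst _ _)).
move=> x _; rewrite normrM ger0_norm ?kern_ge0//.
have [xp|px] := ltP x p; first by rewrite kern_out ?mul0r//; left; exact: ltW.
have [xp|px'] := ltP (p + h) x; first by rewrite kern_out ?mul0r//; right; exact: ltW.
by apply: ler_wpM2l; [exact: kern_ge0|exact: wd].
Qed.

Lemma rho_bounded : exists2 M, 0 < M & forall x, rho x <= M.
Proof.
have cr : {within `[0, 1], continuous rho}.
  by apply: continuous_subspaceT; exact/smooth_continuous/(mollifier_smooth mol).
have [c _ rc] := EVT_max ler01 cr.
have := mollifier_ge0 mol c => c0.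
exists (rho c + 1) => [|x]; first by lra.
have [x0|x0] := leP x 0; first by rewrite (mollifier_out mol); [lra|left].
have [x1|x1] := leP 1 x; first by rewrite (mollifier_out mol); [lra|right].
have : rho x <= rho c by apply: rc; rewrite in_itv/= !ltW.
lra.
Qed.

End mollification.

(** * The du Bois-Reymond lemma *)

Section du_bois_reymond.
Context {R : realType} (L : R).
Implicit Types f g w m : R -> R.
Local Notation mu := (@lebesgue_measure R).
Local Notation I := (`]0, L[%classic : set R).

Let mI : measurable (I : set (measurableTypeR R)). Proof. exact: measurable_itv. Qed.

Lemma near_at_right0P (P : R -> Prop) :
  (\forall h \near 0^'+, P h) <->
  exists2 d, 0 < d & forall h, 0 < h -> h < d -> P h.
Proof.
rewrite near_withinE; split.
  move=> /nbhs_ballP[d /= d0 dP]; exists d => // h h0 hd.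
  by apply: dP => //; rewrite /ball/= sub0r normrN gtr0_norm.
move=> [d d0 dP]; apply/nbhs_ballP; exists d => //= h.
by rewrite /ball/= sub0r normrN => hd h0; apply: dP => //; rewrite gtr0_norm in hd.
Qed.

(** The kernel is at most [M / h] and vanishes off a ball [B] of radius [2 h], so the error is at
    most [M / h] times the integral of [|m - m p|] over [B], which is small relative to [h] at a
    Lebesgue point. *)
Lemma kern_lebesgue_pt rho step ramp p e m : mollifier rho step ramp ->
  itg L m -> lebesgue_pt (m \_ I) p -> 0 < p -> p < L -> 0 < e ->
  exists2 d, 0 < d & forall h, 0 < h -> h < d ->
    `|\int[mu]_(x in I) (kern rho h p x * m x) - m p| <= e.
Proof.
move=> mol mi lp p0 pL e0.
have [M M0 rM] := rho_bounded mol.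
have mp : (m \_ I) p = m p by rewrite patchE ifT// inE/= in_itv/= p0 pL.
(* The ball has measure [4 h] and the kernel is at most [M / h], so a mean oscillation of
   [e / (4 M)] produces an error of exactly [e]. *)
have e1 : 0 < e / (4 * M) by rewrite divr_gt0// mulr_gt0.
move/fine_cvgP : lp => [fin /cvgrPdist_le/(_ _ e1) dav].
have [d1 d10 hd1] := (near_at_right0P _).1 fin.
have [d2 d20 hd2] := (near_at_right0P _).1 dav.
pose d := Num.min (Num.min d1 d2) (Num.min p (L - p)) / 2.
exists d => [|h h0 hd]; first by rewrite divr_gt0// !lt_min d10 d20 p0 subr_gt0.
have : 2 * h < Num.min (Num.min d1 d2) (Num.min p (L - p)).
  by move: hd; rewrite /d ltr_pdivlMr// mulrC.
rewrite !lt_min => /andP[/andP[hh1 hh2] /andP[hp hL]].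
have h20 : 0 < 2 * h by rewrite mulr_gt0.
set B : set (measurableTypeR R) := ball p (2 * h).
have mB : measurable B by exact: measurable_ball.
have BI : B `<=` I.
  by move=> x; rewrite /B /ball/= in_itv/= ltr_norml => /andP[? ?]; apply/andP; split; lra.
pose c x := m x + - m p.
have ci : itg L c by apply: itgD => //; exact/bdd_itg/bdd_cst.
have ciB : mu.-integrable B (EFin \o c) by exact: integrableS ci.
have cnB : mu.-integrable B (EFin \o (fun x => `|c x|)) by exact: integrable_norm.
have muB : mu B = (4 * h)%:E.
  by rewrite /B lebesgue_measure_ball ?mulr_ge0 ?ltW//; congr EFin; ring.
have bound : \int[mu]_(x in B) `|c x| <= e / M * h.
  have davgE : fine (davg (m \_ I) p (2 * h)) = (4 * h)^-1 * \int[mu]_(x in B) `|c x|.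
    rewrite /davg /iavg -/B muB inver gt_eqF ?mulr_gt0//.
    have -> : (\int[mu]_(y in B) `|((center ((m \_ I) p) \o (m \_ I)) y)%:E|)%E
        = (\int[mu]_(x in B) `|c x|%:E)%E.
      apply: eq_integral => x; rewrite inE => /BI Ix.
      by rewrite /= mp patchE ifT ?inE.
    by rewrite fineM//; exact: integrable_fin_num.
  have := hd2 _ h20 hh2; rewrite /= sub0r normrN.
  rewrite davgE ger0_norm; last first.
    apply: mulr_ge0; last exact: Rintegral_ge0.
    by rewrite invr_ge0 mulr_ge0// ltW.
  rewrite mulrC ler_pdivrMr ?mulr_gt0// => /le_trans; apply.
  by rewrite le_eqVlt; apply/orP; left; apply/eqP; field; rewrite gt_eqF.
rewrite (kern_center mol)//; try lra.
have bk := kern_bdd L mol h p.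
have ki : itg L (fun x => kern rho h p x * c x) by exact: itgM.
apply: le_trans (le_normr_Rintegral mI ki) _.
have -> : \int[mu]_(t in I) `|kern rho h p t * c t| =
    \int[mu]_(t in B) `|kern rho h p t * c t|.
  rewrite -(setIidr BI) Rintegral_mkcondr; apply: eq_Rintegral => x _.
  rewrite patchE; case: ifPn => // xB.
  rewrite (kern_out mol h0) ?mul0r ?normr0//.
  apply: contrapT => xh; move/negP: xB; apply; rewrite inE /B /ball/=.
  rewrite ltr_norml; apply/andP; split; apply: contrapT => /negP;
    rewrite -leNgt => ?; apply: xh; [right|left]; lra.
apply: (@le_trans _ _ (\int[mu]_(t in B) (M / h * `|c t|))).
  apply: le_Rintegral => //.
  - by apply: integrable_norm; exact: integrableS ki.
  - exact: (integrableZl mB (M / h) cnB).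
  move=> x _; rewrite normrM ler_wpM2r//.
  rewrite ger0_norm ?(kern_ge0 mol)// /kern /rescale [leRHS]mulrC.
  by rewrite ler_wpM2l// invr_ge0 ltW.
rewrite RintegralZl//.
apply: (@le_trans _ _ (M / h * (e / M * h))).
  by rewrite ler_wpM2l// divr_ge0 ?ltW.
by rewrite le_eqVlt; apply/orP; left; apply/eqP; field; rewrite !gt_eqF.
Qed.

(** A function rising just after [p] and falling just after [q]. Its derivative is a difference of
    two kernels, so testing against it compares averages of [m] near the two points. *)
Lemma test_step_diff rho step ramp h p q : mollifier rho step ramp ->
  0 < h -> 0 < p -> p < q -> q + h < L ->
  test_fun L (fun x => rescale step h p x - rescale step h q x).
Proof.
move=> mol h0 p0 pq qL; split.
  have ss := smooth_step mol.
  have := smoothD (@smooth_rescale _ _ h p ss) (smoothZ (c := -1) (@smooth_rescale _ _ h q ss)).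
  by congr smooth; apply/funext => x; rewrite mulN1r.
apply: (@subset_trans _ `[p, q + h]%classic).
  apply: supp_itv => x [xp|xq]; rewrite /rescale.
    by rewrite !(step_le0 mol) ?subrr//; apply: rescale_arg_le0 => //; lra.
  by rewrite !(step_ge1 mol) ?subrr//; apply: rescale_arg_ge1 => //; lra.
by apply: subset_itv; rewrite bnd_simp.
Qed.

Lemma test_step_diff_derive1 rho step ramp h p q : mollifier rho step ramp ->
  derive1 (fun x : R => rescale step h p x - rescale step h q x) =
  (fun x : R => kern rho h p x - kern rho h q x).
Proof.
move=> mol; apply: is_derive_derive1 => x.
have d h' p' := @is_derive_rescale _ _ _ h' p' (mollifier_step mol).
exact: is_deriveB (d h p x) (d h q x).
Qed.

(** For small [h] the kernel averages at [p] and [q] coincide, and each is within a quarter of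
    [|m p - m q|] of the value of [m]; this forces that distance to be 0. *)
Lemma lebesgue_pt_eq m p q : itg L m ->
  (forall f, test_fun L f -> \int[mu]_(x in I) (m x * derive1 f x) = 0) ->
  lebesgue_pt (m \_ I) p -> lebesgue_pt (m \_ I) q ->
  0 < p -> p < q -> q < L -> m p = m q.
Proof.
move=> mi m0 lp lq p0 pq qL.
have [rho [step [ramp mol]]] := @mollifier_exists R.
apply: contrapT => /eqP mpq.
pose e := `|m p - m q| / 4.
have npq : 0 < `|m p - m q| by rewrite normr_gt0 subr_eq0.
have e0 : 0 < e by rewrite divr_gt0.
have pL := lt_trans pq qL; have q0 := lt_trans p0 pq.
have [d1 d10 hp] := kern_lebesgue_pt mol mi lp p0 pL e0.
have [d2 d20 hq] := kern_lebesgue_pt mol mi lq q0 qL e0.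
pose h := Num.min (Num.min d1 d2) (L - q) / 2.
have h0 : 0 < h by rewrite divr_gt0// !lt_min d10 d20 subr_gt0.
have : h < Num.min (Num.min d1 d2) (L - q).
  by rewrite /h ltr_pdivrMr// ltr_pMr ?ltr1n// !lt_min d10 d20 subr_gt0.
rewrite !lt_min => /andP[/andP[hh1 hh2] hL].
have {}hp := hp h h0 hh1; have {}hq := hq h h0 hh2.
have qhL : q + h < L by lra.
have := m0 _ (test_step_diff mol h0 p0 pq qhL).
rewrite (test_step_diff_derive1 _ _ _ mol).
have kp := itgM (kern_bdd L mol h p) mi.
have kq := itgM (kern_bdd L mol h q) mi.
have -> : \int[mu]_(x in I) (m x * (kern rho h p x - kern rho h q x)) =
  \int[mu]_(x in I) (kern rho h p x * m x - kern rho h q x * m x).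
  by apply: eq_Rintegral => x _; ring.
rewrite RintegralB// => /eqP; rewrite subr_eq0 => /eqP E.
rewrite E in hp.
have := ler_distD (\int[mu]_(x in I) (kern rho h q x * m x)) (m p) (m q).
rewrite distrC in hp; move: npq hp hq; rewrite /e; lra.
Qed.

(** Almost every point is a Lebesgue point of [m] extended by zero, and [m] takes the same value at
    any two of them in the interval. *)
Lemma du_bois_reymond m : itg L m ->
  (forall f, test_fun L f -> \int[mu]_(x in I) (m x * derive1 f x) = 0) ->
  exists c, {ae mu, forall x, I x -> m x = c}.
Proof.
move=> mi m0.
have lae : {ae mu, forall x, lebesgue_pt (m \_ I) x}.
  exact: lebesgue_differentiation (integrable_locally mI mi).
have [[p [Ip lp]]|no] := pselect (exists p, I p /\ lebesgue_pt (m \_ I) p).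
  exists (m p); apply: filterS lae; first exact: (ae_filter_ringOfSetsType mu).
  move=> q lq Iq; move: Ip Iq; rewrite /= !in_itv/= => /andP[p0 pL] /andP[q0 qL].
  have [pq|qp|->//] := ltgtP p q.
    by rewrite (lebesgue_pt_eq mi m0 lp lq).
  by rewrite (lebesgue_pt_eq mi m0 lq lp).
(* With no Lebesgue point inside the interval, almost every point lies outside it and any constant
   will do. *)
exists 0; apply: filterS lae; first exact: (ae_filter_ringOfSetsType mu).
by move=> q lq Iq; exfalso; apply: no; exists q.
Qed.

(** Derivatives of test functions are test functions, so [m] is almost everywhere a constant; a
    kernel of mass 1, carried by the middle third of the interval, evaluates that constant to 0. *)
Lemma ae_eq0_of_test m : 0 < L -> itg L m ->
  (forall f, test_fun L f -> \int[mu]_(x in I) (m x * f x) = 0) ->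
  {ae mu, forall x, I x -> m x = 0}.
Proof.
move=> L0 mi m0.
have [|c mc] := du_bois_reymond mi.
  by move=> f tf; apply: m0; exact: test_derive1.
have [rho [step [ramp mol]]] := @mollifier_exists R.
have h0 : 0 < L / 3 by lra.
have tk : test_fun L (kern rho (L / 3) (L / 3)).
  split; first exact: (smooth_kern mol).
  apply: (@subset_trans _ `[L / 3, L / 3 + L / 3]%classic).
    apply: supp_itv => x xh; apply: (kern_out mol h0).
    by case: xh => ?; [left|right]; lra.
  by apply: subset_itv; rewrite bnd_simp; lra.
have := m0 _ tk.
rewrite (@Rintegral_ae_eq _ _ _ (fun x => c * kern rho (L / 3) (L / 3) x)); last 3 first.
- have := itgM (test_bdd tk) mi; congr itg; apply/funext => x; exact: mulrC.
- exact/bdd_itg/bddZ/test_bdd.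
- apply: filterS mc; first exact: (ae_filter_ringOfSetsType mu).
  by move=> x h /h ->.
rewrite RintegralZl//; last exact/bdd_itg/test_bdd.
rewrite (kern_mass mol)//; [|lra|lra].
by rewrite mulr1 => c0; rewrite c0 in mc.
Qed.

End du_bois_reymond.

(** * Weak bounds on second differences *)

Section weak_second_difference.
Context {R : realType} (L : R).
Implicit Types f g w : R -> R.
Local Notation mu := (@lebesgue_measure R).
Local Notation I := (`]0, L[%classic : set R).

Let mI : measurable (I : set (measurableTypeR R)). Proof. exact: measurable_itv. Qed.

Lemma smooth_cst (a : R) : smooth (fun _ : R => a).
Proof.
apply: (@smooth_coind _ (fun f => exists a, f = fun=> a)); last by exists a.
move=> _ [b ->]; exists (fun=> 0); first by exists 0.
by move=> x; exact: is_derive_cst.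
Qed.

Lemma smooth_id : smooth (fun x : R => x).
Proof.
apply: (@smooth_antiderivative _ _ (fun=> 1) (fun x => is_derive_id x 1)).
exact: smooth_cst.
Qed.

Lemma integral_sqr_test_derive2 f : 0 < L -> test_fun L f ->
  \int[mu]_(x in I) (x ^+ 2 * derive1 (derive1 f) x) = 2 * \int[mu]_(x in I) f x.
Proof.
move=> L0 tf.
have s2 : smooth (fun x : R => x * x) by apply: smoothM; exact: smooth_id.
have d2 : derive1 (fun x : R => x * x) = (fun x => 2 * x).
  apply: is_derive_derive1 => x.
  apply: (is_derive_eq (is_deriveM (is_derive_id x 1) (is_derive_id x 1))).
  by rewrite /GRing.scale /=; ring.
have d1 : derive1 (fun x : R => 2 * x) = (fun=> 2).
  apply: is_derive_derive1 => x.
  apply: (is_derive_eq (is_deriveZ 2 (is_derive_id x 1) : is_derive x 1 (fun y : R => 2 * y) _)).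
  by rewrite /GRing.scale /=; ring.
have s1 : smooth (fun x : R => 2 * x) by apply: smoothZ; exact: smooth_id.
under eq_Rintegral do rewrite expr2.
rewrite (test_by_parts L0 s2 (test_derive1 tf)) d2.
rewrite (test_by_parts L0 s1 tf) d1 opprK RintegralZl//.
exact/bdd_itg/test_bdd.
Qed.

(** As [h] tends to 0 this approaches the tent of height [d] over [[c - d, c + d]]. The factor [h]
    gives the three kernels in its second derivative the weights 1, -2 and 1. *)
Definition tent ramp (h c d x : R) : R :=
  h * (rescale ramp h (c - d) x - 2 * rescale ramp h c x + rescale ramp h (c + d) x).

Section tent.
Variables rho step ramp : R -> R.
Hypothesis mol : mollifier rho step ramp.

Lemma smooth_tent h c d : smooth (tent ramp h c d).
Proof.
have sr p := @smooth_rescale _ _ h p (smooth_ramp mol).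
have := smoothZ (c := h) (smoothD (smoothD (sr (c - d)) (smoothZ (c := - 2) (sr c))) (sr (c + d))).
by congr smooth; apply/funext => x; rewrite /tent mulNr.
Qed.

Lemma tent_derive2 h c d : 0 < h -> derive1 (derive1 (tent ramp h c d)) =
  fun x => kern rho h (c - d) x - 2 * kern rho h c x + kern rho h (c + d) x.
Proof.
move=> h0; have hn0 : h != 0 by rewrite gt_eqF.
have -> : derive1 (tent ramp h c d) =
  fun x => rescale step h (c - d) x - 2 * rescale step h c x + rescale step h (c + d) x.
  apply: is_derive_derive1 => x.
  have dr p := @is_derive_rescale _ _ _ h p (mollifier_ramp mol) x.
  apply: (is_derive_eq (is_deriveZ h (is_deriveD (is_deriveB (dr (c - d))
    (is_deriveZ 2 (dr c))) (dr (c + d))) : is_derive x 1 (tent ramp h c d) _)).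
  by rewrite /GRing.scale /=; field.
apply: is_derive_derive1 => x.
have ds p := @is_derive_rescale _ _ _ h p (mollifier_step mol) x.
exact: (is_deriveD (is_deriveB (ds (c - d)) (is_deriveZ 2 (ds c))) (ds (c + d))).
Qed.

Lemma tent_ge0 h c d x : 0 < h -> 0 < d -> 0 <= tent ramp h c d x.
Proof.
move=> h0 d0.
have hd : 0 < h^-1 * d by rewrite mulr_gt0 ?invr_gt0.
have := ramp_convex (h^-1 * x - h^-1 * c) mol hd.
rewrite /tent /rescale /second_diff => H.
apply: mulr_ge0; first exact: ltW.
rewrite (_ : h^-1 * x + - (h^-1 * (c - d)) = h^-1 * x - h^-1 * c + h^-1 * d); last by ring.
rewrite (_ : h^-1 * x + - (h^-1 * (c + d)) = h^-1 * x - h^-1 * c - h^-1 * d); last by ring.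
lra.
Qed.

(** On the right all three ramps have reached their affine branch, whose second difference is 0. *)
Lemma supp_tent h c d : 0 < h -> 0 < d ->
  supp (tent ramp h c d) `<=` `[c - d, c + d + h].
Proof.
move=> h0 d0; apply: supp_itv => x [xl|xr]; rewrite /tent /rescale.
  rewrite !(ramp_le0 mol); first by ring.
  - by apply: rescale_arg_le0 => //; lra.
  - by apply: rescale_arg_le0 => //; lra.
  - by apply: rescale_arg_le0 => //; lra.
have r p : p + h <= x -> ramp (h^-1 * x + - (h^-1 * p)) = h^-1 * x + - (h^-1 * p) - 1 + ramp 1.
  by move=> px; apply: (ramp_ge1 mol); exact: rescale_arg_ge1.
by rewrite !r; [ring|lra|lra|lra].
Qed.

End tent.

Lemma kern_approx rho step ramp p e w : mollifier rho step ramp ->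
  {within `[0, L], continuous w} -> 0 < p -> p < L -> 0 < e ->
  exists2 d, 0 < d & forall h, 0 < h -> h < d ->
    `|\int[mu]_(x in I) (kern rho h p x * w x) - w p| <= e.
Proof.
move=> mol cw p0 pL e0.
have : w x @[x --> within `[0, L] (nbhs p)] --> w p.
  have pI : `[0, L]%classic p by rewrite /= in_itv/= !ltW.
  by move: p pI {p0 pL}; apply/subspace_continuousP.
move=> /cvgrPdist_le/(_ _ e0); rewrite near_withinE => /nbhs_ballP[d /= d0 dw].
exists (Num.min d (L - p)) => [|h h0]; first by rewrite lt_min d0 subr_gt0.
rewrite lt_min => /andP[hd hL].
apply: (kern_continuous mol) => //; [exact: bdd_continuous|lra|lra|].
move=> x px xh; rewrite distrC; apply: dw.
  by rewrite /ball/= distrC ger0_norm; lra.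
by rewrite /= in_itv/=; apply/andP; split; lra.
Qed.

(** Subtracting [K x^2 / 2] from [w] makes its pairing with the second derivative of a tent
    nonpositive, since pairing [x^2] with [f''] gives twice the integral of [f]. That pairing
    approximates the second difference at [c], so a positive excess is contradicted at a single
    small [h]. *)
Lemma second_diff_weak w K a b c d : 0 <= a -> b <= L ->
  {within `[0, L], continuous w} ->
  (forall f, test_fun L f -> supp f `<=` `]a, b[ -> (forall x, 0 <= f x) ->
     \int[mu]_(x in I) (w x * derive1 (derive1 f) x) <= K * \int[mu]_(x in I) f x) ->
  0 < d -> a < c - d -> c + d < b -> second_diff w c d <= K * d ^+ 2.
Proof.
move=> a0 bL cw H d0 ac cb.
(* The closing linear arithmetic, stated over plain variables so that no integral occurs in it. *)
have lin (W P A B C x y z s e : R) : W <= K * P ->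
    W - K * P = A + - 2 * B + C -> - e <= A - x -> B - y <= e -> - e <= C - z ->
    z + x - 2 * y = s -> s = 8 * e -> 0 < e -> False by lra.
have L0 : 0 < L by lra.
have [rho [step [ramp mol]]] := @mollifier_exists R.
pose v x := w x + - K / 2 * x ^+ 2.
have cv : {within `[0, L], continuous v}.
  apply/subspace_continuousP => x xI; apply: cvgD.
    by move: x xI; apply/subspace_continuousP.
  apply: cvgM; first exact: cvg_cst.
  by apply: cvg_within_filter; exact: exprn_continuous.
rewrite leNgt; apply/negP => bad.
(* The kernel errors, weighted 1, 2 and 1, add up to [4 e], half of the excess [8 e]. *)
pose e := (second_diff w c d - K * d ^+ 2) / 8.
have e0 : 0 < e by rewrite divr_gt0// subr_gt0.
have [||d1 d10 h1] := @kern_approx rho step ramp (c - d) e v mol cv _ _ e0; [lra|lra|].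
have [||d2 d20 h2] := @kern_approx rho step ramp c e v mol cv _ _ e0; [lra|lra|].
have [||d3 d30 h3] := @kern_approx rho step ramp (c + d) e v mol cv _ _ e0; [lra|lra|].
pose m := Num.min (Num.min d1 d2) (Num.min d3 (b - c - d)).
have m0 : 0 < m by rewrite !lt_min d10 d20 d30/=; lra.
pose h := m / 2.
have h0 : 0 < h by rewrite divr_gt0.
have : h < m by rewrite /h; lra.
rewrite /m !lt_min => /andP[/andP[hd1 hd2] /andP[hd3 hb]].
have {}h1 := h1 h h0 hd1; have {}h2 := h2 h h0 hd2; have {}h3 := h3 h h0 hd3.
have sab : supp (tent ramp h c d) `<=` `]a, b[.
  apply: subset_trans (supp_tent mol h0 d0) _.
  by apply: subset_itv; rewrite bnd_simp//; lra.
have tf : test_fun L (tent ramp h c d).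
  split; first exact: (smooth_tent mol).
  by apply: subset_trans sab _; apply: subset_itv; rewrite bnd_simp.
have HW := H _ tf sab (fun x => tent_ge0 mol c x h0 d0).
have bw := bdd_continuous cw; have bv := bdd_continuous cv.
have sq := integral_sqr_test_derive2 L0 tf.
have t2 := test_bdd (test_derive1 (test_derive1 tf)).
have i1 : itg L (fun x => w x * derive1 (derive1 (tent ramp h c d)) x).
  exact/bdd_itg/bddM.
have i2 : itg L (fun x => x ^+ 2 * derive1 (derive1 (tent ramp h c d)) x).
  apply/bdd_itg/bddM => //; apply: smooth_bdd.
  by have := smoothM smooth_id smooth_id; congr smooth; apply/funext => x; rewrite expr2.
have E1 : \int[mu]_(x in I) (v x * derive1 (derive1 (tent ramp h c d)) x) =
  \int[mu]_(x in I) (w x * derive1 (derive1 (tent ramp h c d)) x)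
  - K * \int[mu]_(x in I) tent ramp h c d x.
  transitivity (\int[mu]_(x in I) (w x * derive1 (derive1 (tent ramp h c d)) x +
    - K / 2 * (x ^+ 2 * derive1 (derive1 (tent ramp h c d)) x))).
    by apply: eq_Rintegral => x _; rewrite /v; ring.
  rewrite RintegralD//; last exact: itgZ.
  by rewrite RintegralZl// sq; field.
have k p := itgM (kern_bdd L mol h p) (bdd_itg bv).
have E2 : \int[mu]_(x in I) (v x * derive1 (derive1 (tent ramp h c d)) x) =
  \int[mu]_(x in I) (kern rho h (c - d) x * v x)
  + - 2 * \int[mu]_(x in I) (kern rho h c x * v x)
  + \int[mu]_(x in I) (kern rho h (c + d) x * v x).
  transitivity (\int[mu]_(x in I) (kern rho h (c - d) x * v x +
    - 2 * (kern rho h c x * v x) + kern rho h (c + d) x * v x)).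
    by apply: eq_Rintegral => x _; rewrite (tent_derive2 mol _ _ h0); ring.
  rewrite RintegralD//; last 2 first.
  - by apply: itgD; [exact: k|exact: itgZ].
  - exact: k.
  rewrite RintegralD//; last 2 first.
  - exact: k.
  - exact: itgZ.
  by rewrite RintegralZl//; exact: k.
have sv : second_diff v c d = second_diff w c d - K * d ^+ 2.
  by rewrite /second_diff /v; field.
move: h1 h2 h3; rewrite !ler_norml => /andP[h1 _] /andP[_ h2] /andP[h3 _].
have e8 : second_diff w c d - K * d ^+ 2 = 8 * e by rewrite /e; field.
exact: (lin _ _ _ _ _ _ _ _ _ _ HW (etrans (esym E1) E2) h1 h2 h3 sv e8 e0).
Qed.

End weak_second_difference.

(** * First variation of the functional *)

Section first_variation.
Context {R : realType} (L eps eta : R).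
Hypotheses (L0 : 0 < L) (eps0 : 0 < eps) (eta0 : 0 < eta).
Implicit Types f g u v w p q psi phi : R -> R.
Local Notation mu := (@lebesgue_measure R).
Local Notation I := (`]0, L[%classic : set R).

Let mI : measurable (I : set (measurableTypeR R)). Proof. exact: measurable_itv. Qed.

Lemma test_cst0 : test_fun L (fun=> 0).
Proof.
split; first exact: smooth_cst.
rewrite /supp (_ : [set x | _] = set0) ?closure0//.
by apply/seteqP; split => x //=; rewrite eqxx.
Qed.

Lemma weakD_spec u : H1 L u -> L2 L (weakD L u) /\ weak_derivative L u (weakD L u).
Proof. by case=> _ _ hg; exact: (xgetPex (cst 0) hg). Qed.

Lemma H1_bdd u : H1 L u -> bdd_mfun L u.
Proof. by case=> cu _ _; exact: bdd_continuous. Qed.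

(** [weakD] is a choice among representatives, so it is not additive by construction. The function
    [weakD L u + t f'] is also a square-integrable weak derivative of the perturbed function, and
    two such derivatives agree almost everywhere by [ae_eq0_of_test]. *)
Lemma weakD_perturb u f t : H1 L u -> test_fun L f ->
  L2 L (weakD L (fun x => u x + t * f x)) /\
  {ae mu, forall x, I x -> weakD L (fun x => u x + t * f x) x =
                           weakD L u x + t * derive1 f x}.
Proof.
move=> Hu tf; have [up uw] := weakD_spec Hu.
have bu := H1_bdd Hu; have bf := test_bdd tf.
have bf' := test_bdd (test_derive1 tf).
pose g x := weakD L u x + t * derive1 f x.
have g2 : L2 L g by apply: L2D => //; exact/bdd_L2/bddZ.
have gw : weak_derivative L (fun x => u x + t * f x) g.
  move=> k tk.
  have bk := test_bdd tk; have bk' := test_bdd (test_derive1 tk).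
  transitivity (\int[mu]_(x in I) (u x * derive1 k x + t * (f x * derive1 k x))).
    by apply: eq_Rintegral => x _; ring.
  transitivity (- \int[mu]_(x in I) (k x * weakD L u x + t * (derive1 f x * k x))); last first.
    by congr (- _); apply: eq_Rintegral => x _; rewrite /g; ring.
  rewrite RintegralD//; last 2 first.
  - exact/bdd_itg/bddM.
  - exact/itgZ/bdd_itg/bddM.
  rewrite RintegralD//; last 2 first.
  - exact/itgM/L2_itg.
  - exact/itgZ/bdd_itg/bddM.
  rewrite !RintegralZl//; last 2 first.
  - exact/bdd_itg/bddM.
  - exact/bdd_itg/bddM.
  rewrite (uw k tk) (test_by_parts L0 (test_smooth tf) tk).
  have -> : \int[mu]_(x in I) (k x * weakD L u x) = \int[mu]_(x in I) (weakD L u x * k x).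
    by apply: eq_Rintegral => x _; rewrite mulrC.
  by rewrite opprD mulrN.
have [h2 hw] : L2 L (weakD L (fun x => u x + t * f x)) /\
    weak_derivative L (fun x => u x + t * f x) (weakD L (fun x => u x + t * f x)).
  by apply: (@xgetPex _ (cst 0) [set g | L2 L g /\ weak_derivative L _ g]); exists g.
split=> //.
pose m x := weakD L (fun x => u x + t * f x) x + - 1 * g x.
have mi : itg L m by apply: itgD; [exact: L2_itg|exact/itgZ/L2_itg].
have m0 k : test_fun L k -> \int[mu]_(x in I) (m x * k x) = 0.
  move=> tk; have bk := test_bdd tk.
  transitivity (\int[mu]_(x in I) (k x * weakD L (fun x => u x + t * f x) x + - 1 * (k x * g x))).
    by apply: eq_Rintegral => x _; rewrite /m; ring.
  rewrite RintegralD//; last 2 first.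
  - exact/itgM/L2_itg.
  - exact/itgZ/itgM/L2_itg.
  rewrite RintegralZl//; last exact/itgM/L2_itg.
  have := etrans (esym (hw k tk)) (gw k tk) => /oppr_inj E.
  rewrite mulN1r; apply/eqP; rewrite subr_eq0; apply/eqP.
  transitivity (\int[mu]_(x in I) (weakD L (fun x => u x + t * f x) x * k x)).
    by apply: eq_Rintegral => x _; rewrite mulrC.
  by rewrite E; apply: eq_Rintegral => x _; rewrite mulrC.
apply: filterS (ae_eq0_of_test L0 mi m0); first exact: (ae_filter_ringOfSetsType mu).
by move=> x h /h; rewrite /m mulN1r => /eqP; rewrite subr_eq0 => /eqP.
Qed.

Definition AT_density v p q (x : R) : R :=
  (eta + v x ^+ 2) * `|p x| ^+ 2 + (1 - v x) ^+ 2 / eps + eps * `|q x| ^+ 2.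

Lemma bdd_coeff v : bdd_mfun L v -> bdd_mfun L (fun x => eta + v x ^+ 2).
Proof. by move=> bv; exact: (bddD (bdd_cst L eta) (bddM bv bv)). Qed.

Lemma itg_AT_density v p q : bdd_mfun L v -> L2 L p -> L2 L q ->
  itg L (AT_density v p q).
Proof.
move=> bv p2 q2.
have b1 := bddD (bdd_cst L 1) (bddZ (-1) bv).
have := itgD (itgD (itgM (bdd_coeff bv) (L2_mulM p2 p2))
  (itgZ eps^-1 (bdd_itg (bddM b1 b1)))) (itgZ eps (L2_mulM q2 q2)).
congr itg; apply/funext => x; rewrite /AT_density !real_normK ?num_real//.
by ring.
Qed.

(** In the first variation the term [eps v' phi'] is integrated by parts into [- eps v phi''], so
    that it involves only the continuous function [v], as [second_diff_weak] requires. *)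
Definition AT_variation u v psi phi : R :=
  2 * (\int[mu]_(x in I) ((eta + v x ^+ 2) * weakD L u x * derive1 psi x)
       + \int[mu]_(x in I) (((v x - 1) / eps + v x * weakD L u x ^+ 2) * phi x)
       - eps * \int[mu]_(x in I) (v x * derive1 (derive1 phi) x)).

Lemma Rintegral_poly4 t (c0 c1 c2 c3 c4 : R -> R) :
  itg L c0 -> itg L c1 -> itg L c2 -> itg L c3 -> itg L c4 ->
  \int[mu]_(x in I) (c0 x + (t * c1 x + (t ^+ 2 * c2 x + (t ^+ 3 * c3 x + t ^+ 4 * c4 x)))) =
  \int[mu]_(x in I) c0 x + t * \int[mu]_(x in I) c1 x + t ^+ 2 * \int[mu]_(x in I) c2 x
  + t ^+ 3 * \int[mu]_(x in I) c3 x + t ^+ 4 * \int[mu]_(x in I) c4 x.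
Proof.
move=> i0 i1 i2 i3 i4.
have z1 := itgZ t i1; have z2 := itgZ (t ^+ 2) i2; have z3 := itgZ (t ^+ 3) i3.
have z4 := itgZ (t ^+ 4) i4.
have s3 := itgD z3 z4; have s2 := itgD z2 s3; have s1 := itgD z1 s2.
by rewrite !RintegralD// !RintegralZl// !addrA.
Qed.

(** Almost everywhere the perturbed density is a polynomial of degree 4 in [t] with integrable
    coefficients. The expansion is exact, so no differentiation under the integral sign occurs. *)
Lemma AT_perturb u v psi phi : H1 L u -> H1 L v ->
  test_fun L psi -> test_fun L phi ->
  exists A2 A3 A4 : R, forall t,
    AT L eps eta (fun x => u x + t * psi x) (fun x => v x + t * phi x) =
    AT L eps eta u v + t * AT_variation u v psi phi
    + t ^+ 2 * A2 + t ^+ 3 * A3 + t ^+ 4 * A4.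
Proof.
move=> Hu Hv tpsi tphi.
have [p2 _] := weakD_spec Hu; have [q2 qw] := weakD_spec Hv.
have bv := H1_bdd Hv.
have bF := test_bdd tphi; have bP := test_bdd (test_derive1 tpsi).
have bQ := test_bdd (test_derive1 tphi).
set p := weakD L u in p2 *; set q := weakD L v in q2 qw *.
set P := derive1 psi in bP *; set Q := derive1 phi in bQ *.
have pi := L2_itg p2; have qi := L2_itg q2; have ppi := L2_mulM p2 p2.
pose c2 x := phi x * phi x * (p x * p x) + 4 * (v x * phi x * P x * p x)
  + ((eta + v x ^+ 2) * (P x * P x) + (eps^-1 * (phi x * phi x) + eps * (Q x * Q x))).
have i2 : itg L c2.
  apply: itgD; first apply: itgD.
  - exact: itgM (bddM bF bF) ppi.
  - exact/itgZ/(itgM (bddM (bddM bv bF) bP) pi).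
  - apply/bdd_itg/bddD; first exact: bddM (bdd_coeff bv) (bddM bP bP).
    by apply: bddD; apply: bddZ; exact: bddM.
pose c3 x := 2 * (phi x * phi x * P x * p x) + 2 * (v x * phi x * (P x * P x)).
have i3 : itg L c3.
  apply: itgD; apply: itgZ; first exact: itgM (bddM (bddM bF bF) bP) pi.
  exact/bdd_itg/(bddM (bddM bv bF) (bddM bP bP)).
pose c4 x := phi x * phi x * (P x * P x).
have i4 : itg L c4 by exact/bdd_itg/(bddM (bddM bF bF) (bddM bP bP)).
pose m x := (eta + v x ^+ 2) * p x * P x.
pose n x := ((v x - 1) / eps + v x * p x ^+ 2) * phi x.
have mi : itg L m.
  have := itgM (bddM (bdd_coeff bv) bP) pi; congr itg.
  by apply/funext => x; rewrite /m; ring.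
have ni : itg L n.
  have := itgD (bdd_itg (bddM (bddZ eps^-1 (bddD bv (bdd_cst L (-1)))) bF))
    (itgM (bddM bv bF) ppi).
  by congr itg; apply/funext => x; rewrite /n; ring.
have Qi : itg L (fun x => q x * Q x).
  by have := itgM bQ qi; congr itg; apply/funext => x; rewrite mulrC.
pose c1 x := 2 * (m x + n x + eps * (q x * Q x)).
have i1 : itg L c1 by apply/itgZ/itgD; [exact: itgD|exact: itgZ].
have i0 := itg_AT_density bv p2 q2.
exists (\int[mu]_(x in I) c2 x), (\int[mu]_(x in I) c3 x), (\int[mu]_(x in I) c4 x) => t.
have [pt2 pt] := weakD_perturb t Hu tpsi; have [qt2 qt] := weakD_perturb t Hv tphi.
have -> : AT_variation u v psi phi = \int[mu]_(x in I) c1 x.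
  rewrite /c1 RintegralZl//; last by apply: itgD; [exact: itgD|exact: itgZ].
  rewrite RintegralD//; last 2 first.
  - exact: itgD.
  - exact: itgZ.
  rewrite RintegralD// RintegralZl// /AT_variation.
  by rewrite (qw _ (test_derive1 tphi)) mulrN opprK.
rewrite -Rintegral_poly4//.
apply: Rintegral_ae_eq.
- apply: itg_AT_density => //; exact: bddD bv (bddZ t bF).
- have s3 := itgD (itgZ (t ^+ 3) i3) (itgZ (t ^+ 4) i4).
  exact: itgD i0 (itgD (itgZ t i1) (itgD (itgZ (t ^+ 2) i2) s3)).
move: pt qt; apply: filterS2; first exact: (ae_filter_ringOfSetsType mu).
move=> x hp hq Ix; rewrite (hp Ix) (hq Ix).
rewrite !real_normK ?num_real// /c1 /c2 /c3 /c4 /m /n -/p -/q -/P -/Q.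
by field; rewrite gt_eqF.
Qed.

Lemma poly4_cvg (A1 A2 A3 A4 : R) :
  A1 + t * (A2 + t * A3 + t ^+ 2 * A4) @[t --> (0 : R)] --> A1.
Proof.
have c : continuous (fun t : R => A1 + t * (A2 + t * A3 + t ^+ 2 * A4)).
  move=> t; apply: cvgD; first exact: cvg_cst.
  apply: cvgM; first exact: cvg_id.
  apply: cvgD; last by apply: cvgM; [exact: exprn_continuous|exact: cvg_cst].
  by apply: cvgD; [exact: cvg_cst|apply: cvgM; [exact: cvg_id|exact: cvg_cst]].
by have := c 0; rewrite /continuous_at mul0r addr0.
Qed.

Lemma AT_critical_variation a u v psi phi : AT_critical L a eps eta u v ->
  test_fun L psi -> test_fun L phi -> AT_variation u v psi phi = 0.
Proof.
case=> [[Hu Hv] _ _ crit] tpsi tphi.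
have [A2 [A3 [A4 E]]] := AT_perturb Hu Hv tpsi tphi.
have c1 := crit psi phi tpsi tphi.
have c2 : AT_variation u v psi phi + t * (A2 + t * A3 + t ^+ 2 * A4)
    @[t --> (0 : R)^'] --> AT_variation u v psi phi.
  by apply: cvg_within_filter; exact: poly4_cvg.
apply: (cvg_unique _ c2 _) => //.
apply: cvg_trans c1; apply: near_eq_cvg.
rewrite /dnbhs near_withinE; apply: nearW => t t0.
by rewrite E; field.
Qed.

Lemma obstacle_AT_variation a v0 u v psi phi : obstacle_AT_critical L a eps eta v0 u v ->
  test_fun L psi -> test_fun L phi ->
  ((forall x, 0 <= phi x) -> AT_variation u v psi phi <= 0) /\
  (supp phi `<=` [set x | (x \in `]0, L[) /\ v x < v0 x] -> AT_variation u v psi phi = 0).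
Proof.
case=> [[Hu Hv] _ _ _ crit] tpsi tphi.
have [A2 [A3 [A4 E]]] := AT_perturb Hu Hv tpsi tphi.
have [D [c1 D1 D2]] := crit psi phi tpsi tphi.
suff -> : AT_variation u v psi phi = D by [].
(* The expansion is used at [- t] and the difference is reversed, which flips the sign of the
   even-order coefficients only. *)
have c2 : AT_variation u v psi phi + t * ((- A2) + t * A3 + t ^+ 2 * (- A4))
    @[t --> (0 : R)^'+] --> AT_variation u v psi phi.
  by apply: cvg_within_filter; exact: poly4_cvg.
apply: (cvg_unique _ c2 _) => //.
apply: cvg_trans c1; apply: near_eq_cvg.
rewrite near_withinE; apply: nearW => t t0.
have -> : (fun x => u x - t * psi x) = (fun x => u x + (- t) * psi x).
  by apply/funext => x; rewrite mulNr.
have -> : (fun x => v x - t * phi x) = (fun x => v x + (- t) * phi x).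
  by apply/funext => x; rewrite mulNr.
by rewrite E; field; rewrite gt_eqF.
Qed.

End first_variation.

(** * Regularity *)

Section regularity.
Context {R : realType} (L eps eta : R).
Hypotheses (L0 : 0 < L) (eps0 : 0 < eps) (eta0 : 0 < eta).
Implicit Types u v psi phi : R -> R.
Local Notation mu := (@lebesgue_measure R).
Local Notation I := (`]0, L[%classic : set R).

Let mI : measurable (I : set (measurableTypeR R)). Proof. exact: measurable_itv. Qed.

Lemma AT_variation_psi u v psi :
  AT_variation L eps eta u v psi (fun=> 0) =
  2 * \int[mu]_(x in I) ((eta + v x ^+ 2) * weakD L u x * derive1 psi x).
Proof.
rewrite /AT_variation.
have d0 (a : R) : derive1 (fun _ : R => a) = fun=> 0.
  by apply: is_derive_derive1 => x; exact: is_derive_cst.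
rewrite !d0.
have i0 f : \int[mu]_(x in I) (f x * 0) = 0.
  by under eq_Rintegral do rewrite mulr0; rewrite Rintegral_cst// mul0r.
by rewrite !i0 mulr0 subr0 addr0.
Qed.

Lemma AT_variation_phi u v phi :
  AT_variation L eps eta u v (fun=> 0) phi =
  2 * (\int[mu]_(x in I) (((v x - 1) / eps + v x * weakD L u x ^+ 2) * phi x)
       - eps * \int[mu]_(x in I) (v x * derive1 (derive1 phi) x)).
Proof.
rewrite /AT_variation.
have d0 (a : R) : derive1 (fun _ : R => a) = fun=> 0.
  by apply: is_derive_derive1 => x; exact: is_derive_cst.
rewrite !d0.
have i0 f : \int[mu]_(x in I) (f x * 0) = 0.
  by under eq_Rintegral do rewrite mulr0; rewrite Rintegral_cst// mul0r.
by rewrite !i0 add0r.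
Qed.

(* The first equation makes [u' (eta + v^2)] constant, hence [u'] bounded. *)
Lemma zero_order_term_bound u v : H1 L u -> H1 L v ->
  (forall psi, test_fun L psi -> AT_variation L eps eta u v psi (fun=> 0) = 0) ->
  exists2 M, 0 <= M & forall phi, test_fun L phi -> (forall x, 0 <= phi x) ->
    `|\int[mu]_(x in I) (((v x - 1) / eps + v x * weakD L u x ^+ 2) * phi x)|
      <= M * \int[mu]_(x in I) phi x.
Proof.
move=> Hu Hv var0.
have [p2 _] := weakD_spec Hu; set p := weakD L u in p2 *.
have bv := H1_bdd Hv; have pi := L2_itg p2.
have cpos x : 0 < eta + v x ^+ 2 by rewrite ltr_pwDl// sqr_ge0.
have [||c cE] := @du_bois_reymond _ L (fun x => (eta + v x ^+ 2) * p x).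
- exact: itgM (bdd_coeff eta bv) pi.
- move=> f tf; have := var0 f tf; rewrite AT_variation_psi => /eqP.
  by rewrite mulf_eq0 pnatr_eq0 => /eqP.
(* The zero-order term with [u'] replaced by [c / (eta + v^2)]: it is continuous on [[0, L]], as the
   denominator is positive, and hence bounded. *)
pose n x := (v x - 1) / eps + v x * (c / (eta + v x ^+ 2)) ^+ 2.
have cn : {within `[0, L], continuous n}.
  have [cv _ _] := Hv.
  apply/subspace_continuousP => x xI.
  have vx : v y @[y --> within `[0, L] (nbhs x)] --> v x.
    by move: x xI; apply/subspace_continuousP.
  have vv : eta + v y ^+ 2 @[y --> within `[0, L] (nbhs x)] --> eta + v x ^+ 2.
    by apply: cvgD; [exact: cvg_cst|rewrite expr2; exact: cvgM].
  have cc : c / (eta + v y ^+ 2) @[y --> within `[0, L] (nbhs x)] --> c / (eta + v x ^+ 2).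
    by apply: cvgM; [exact: cvg_cst|apply: cvgV => //; rewrite gt_eqF].
  apply: cvgD.
    by apply: cvgM; [apply: cvgB => //; exact: cvg_cst|exact: cvg_cst].
  by apply: cvgM => //; rewrite expr2; exact: cvgM.
have bn := bdd_continuous cn; have [_ [M nM]] := bn.
(* The midpoint serves only to see that the bound [M] is nonnegative. *)
have LH : 0 < L / 2 < L by rewrite divr_gt0//= ltr_pdivrMr// ltr_pMr// ltr1n.
exists M => [|phi tphi phi0].
  by case/andP: LH => l1 l2; apply: le_trans (nM _ l1 l2).
have bphi := test_bdd tphi.
have bnphi := bddM bn bphi.
have -> : \int[mu]_(x in I) (((v x - 1) / eps + v x * p x ^+ 2) * phi x) =
    \int[mu]_(x in I) (n x * phi x).
  apply: Rintegral_ae_eq.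
  - have := itgD (bdd_itg (bddM (bddZ eps^-1 (bddD bv (bdd_cst L (-1)))) bphi))
      (itgM (bddM bv bphi) (L2_mulM p2 p2)).
    by congr itg; apply/funext => x; ring.
  - exact: bdd_itg.
  - apply: filterS cE; first exact: (ae_filter_ringOfSetsType mu).
    move=> x h Ix; rewrite /n -(h Ix) [_ / (eta + v x ^+ 2)]mulrC mulKf//.
    by rewrite gt_eqF.
apply: le_trans (le_normr_Rintegral mI (bdd_itg bnphi)) _.
rewrite -RintegralZl//; last exact: bdd_itg.
apply: le_Rintegral => //.
- exact: (integrable_norm (bdd_itg bnphi)).
- exact/itgZ/bdd_itg.
move=> x /=; rewrite in_itv/= => /andP[x0 xL].
by rewrite normrM [`|phi x|]ger0_norm// ler_wpM2r// nM.
Qed.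

Lemma obstacle_C11 a0 a1 u0 v0 u v :
  AT_critical L a0 eps eta u0 v0 ->
  obstacle_AT_critical L a1 eps eta v0 u v ->
  C11 0 L v.
Proof.
move=> crit0 crit.
have [[Hu0 Hv0] _ _ _] := crit0.
have [[Hu Hv] vv0 _ _ _] := crit.
have [cv _ _] := Hv; have [cv0 _ _] := Hv0.
have t0 := @test_cst0 R L.
have var0 psi phi := AT_critical_variation L0 eps0 crit0 (psi := psi) (phi := phi).
have var psi phi := obstacle_AT_variation L0 eps0 crit (psi := psi) (phi := phi).
have [|M0 M00 bM0] := zero_order_term_bound Hu0 Hv0.
  by move=> psi tpsi; exact: var0.
have [|M M_0 bM] := zero_order_term_bound Hu Hv.
  (* For [phi = 0] the support is empty, hence inside the non-contact set, so the equality clause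
     gives the first equation for every [psi]. *)
  move=> psi tpsi; apply: (var _ _ tpsi t0).2.
  rewrite /supp (_ : [set x | _] = set0) ?closure0//.
  by apply/seteqP; split => x //=; rewrite eqxx.
pose K0 := M0 / eps; pose K := M / eps.
have K0E : eps * K0 = M0 by rewrite mulrC divfK// gt_eqF.
have KE : eps * K = M by rewrite mulrC divfK// gt_eqF.
have sd0 c d : 0 < d -> 0 < c - d -> c + d < L -> second_diff v0 c d <= K0 * d ^+ 2.
  apply: (@second_diff_weak _ L v0 K0 0 L) => // f tf _ f0.
  have := var0 _ _ t0 tf; rewrite AT_variation_phi => /eqP.
  rewrite mulf_eq0 pnatr_eq0/= subr_eq0 => /eqP E.
  have := bM0 f tf f0; rewrite E ler_norml => /andP[_].
  by move=> ub; rewrite -(ler_pM2l eps0) [leRHS]mulrA K0E.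
have sdN c d : 0 < d -> 0 < c - d -> c + d < L ->
    second_diff (fun x => - v x) c d <= K * d ^+ 2.
  apply: (@second_diff_weak _ L (fun x => - v x) K 0 L) => //.
    by move=> x; apply: cvgN; exact: cv.
  move=> f tf _ f0.
  (* The sign condition bounds the zero-order integral above by [eps] times the integral of [v f'']:
     a lower bound on [v''] that holds across the contact set. *)
  have := (var _ _ t0 tf).1 f0; rewrite AT_variation_phi => E.
  have := bM f tf f0; rewrite ler_norml => /andP[bl _].
  have -> : \int[mu]_(x in I) (- v x * derive1 (derive1 f) x) =
      - \int[mu]_(x in I) (v x * derive1 (derive1 f) x).
    rewrite -mulN1r -RintegralZl//; last first.
      exact/bdd_itg/(bddM (H1_bdd Hv) (test_bdd (test_derive1 (test_derive1 tf)))).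
    by apply: eq_Rintegral => x _; rewrite mulN1r mulNr.
  by rewrite -(ler_pM2l eps0) [leRHS]mulrA KE mulrN; lra.
have sdO c : 0 < c -> c < L -> v c < v0 c -> exists2 e, 0 < e &
    forall d, 0 < d -> d < e -> second_diff v c d <= K * d ^+ 2.
  move=> c0 cL vc.
  have cI : `[0, L]%classic c by rewrite /= in_itv/= !ltW.
  have vx : v0 y - v y @[y --> within `[0, L] (nbhs c)] --> v0 c - v c.
    by move: c cI {c0 cL vc}; apply/subspace_continuousP => x; apply: cvgB; [exact: cv0|exact: cv].
  have : \forall y \near within `[0, L] (nbhs c), 0 < v0 y - v y.
    by apply: (cvgr_gt _ vx); rewrite subr_gt0.
  rewrite near_withinE => /nbhs_ballP[r /= r0 hr].
  pose e := Num.min r (Num.min c (L - c)) / 2.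
  have m0 : 0 < Num.min r (Num.min c (L - c)) by rewrite !lt_min r0 c0/= subr_gt0.
  have e0 : 0 < e by rewrite divr_gt0.
  have : e < Num.min r (Num.min c (L - c)) by rewrite /e; lra.
  rewrite !lt_min => /and3P[er ec eL].
  exists e => // d d0 de.
  (* Test functions supported in this interval live in the non-contact set, where the variation
     vanishes and the second equation becomes available. *)
  apply: (@second_diff_weak _ L v K (c - e) (c + e)) => //; try lra.
  move=> f tf sf f0.
  have sO : supp f `<=` [set x | (x \in `]0, L[) /\ v x < v0 x].
    move=> x /sf /=; rewrite in_itv/= => /andP[xl xr].
    rewrite in_itv/=; split; first by apply/andP; split; lra.
    rewrite -subr_gt0; apply: hr; last by rewrite /= in_itv/=; apply/andP; split; lra.
    by rewrite /ball/= ltr_norml; apply/andP; split; lra.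
  have := (var _ _ t0 tf).2 sO; rewrite AT_variation_phi => /eqP.
  rewrite mulf_eq0 pnatr_eq0/= subr_eq0 => /eqP E.
  have := bM f tf f0; rewrite E ler_norml => /andP[_].
  by move=> ub; rewrite -(ler_pM2l eps0) [leRHS]mulrA KE.
have K00 : 0 <= K0 by rewrite divr_ge0// ltW.
have K_0 : 0 <= K by rewrite divr_ge0// ltW.
(* [K] serves off the contact set and [K0] on it; [K + K0] dominates both, and the [+ 1] is the
   strict gap asked for by [semiconcave_local]. *)
pose C := K + K0 + 1.
have C0 : 0 <= C by rewrite /C; lra.
apply: (C11_semiconcave C0).
- apply: (@semiconcave_local _ L (K + K0)) => //; first by rewrite /C; lra.
  move=> c c0 cL.
  have d2 (d a : R) : a <= K * d ^+ 2 \/ a <= K0 * d ^+ 2 -> a <= (K + K0) * d ^+ 2.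
    have := mulr_ge0 K_0 (sqr_ge0 d); have := mulr_ge0 K00 (sqr_ge0 d).
    by rewrite mulrDl => ? ? []; lra.
  have cI : c \in `[0, L] by rewrite in_itv/= !ltW.
  have := vv0 c cI; rewrite le_eqVlt => /predU1P[vc|vc]; last first.
    have [e e0 he] := sdO c c0 cL vc.
    by exists e => // d d0 de; apply: d2; left; exact: he.
  (* On the contact set, [v] touches [v0] from below. *)
  exists (Num.min c (L - c)) => [|d d0]; first by rewrite lt_min c0 subr_gt0.
  rewrite lt_min => /andP[dc dL]; apply: d2; right.
  apply: le_trans (sd0 c d d0 _ _); [|lra|lra].
  have h1 : v (c + d) <= v0 (c + d) by apply: vv0; rewrite in_itv/=; apply/andP; split; lra.
  have h2 : v (c - d) <= v0 (c - d) by apply: vv0; rewrite in_itv/=; apply/andP; split; lra.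
  by rewrite /second_diff; lra.
- apply: (@semiconcave_local _ L K); first by rewrite /C; lra.
    by move=> x; apply: cvgN; exact: cv.
  move=> c c0 cL; exists (Num.min c (L - c)) => [|d d0]; first by rewrite lt_min c0 subr_gt0.
  by rewrite lt_min => /andP[dc dL]; apply: sdN; lra.
Qed.

End regularity.

Unset Implicit Arguments.

Theorem theorem2p5 (R : realType) (L a0 a1 eps eta : R)
    (u0 v0 u v : R -> R) :
  0 < L -> 0 < eps -> 0 < eta ->
  AT_critical L a0 eps eta u0 v0 ->
  obstacle_AT_critical L a1 eps eta v0 u v ->
  C11 0 L v.
Proof.
move=> L0 eps0 eta0 crit0 crit.
exact: (obstacle_C11 L0 eps0 eta0 crit0 crit).
Qed.
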